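(* Let $f\in\mathbb{C}[X_1,\ldots,X_n]^n$ be a square polynomial system with a deflation-one singular zero $\xi\in\mathbb{C}^n$, let $\kappa=\dim\ker Df(\xi)$, and let $x\in\mathbb{C}^n$ be an approximation of $\xi$ such that $\epsilon=\|x-\xi\|$, $0<\epsilon<1$, is sufficiently small. Then, applying the two-step Newton's method (described in the context) iteratively, the approximation $x$ converges quadratically to the exact zero $\xi$.
   Context: Notation. $Df(x)$ is the Jacobian matrix of $f$ at $x$; $D^2f(x)$ is the $n\times n\times n$ tensor of second partial derivatives, and for a vector $u$, $D^2f(x)\cdot u$ is the $n\times n$ matrix with $(i,j)$ entry $\sum_k\frac{\partial^2 f_i}{\partial X_j\partial X_k}(x)u_k$. $^*$ is conjugate transpose, and $\|\cdot\|$ is the Euclidean norm on vectors. Quadratic convergence means that one iteration, taking $x$ to $x''$, satisfies $\|x''-\xi\|=\mathcal{O}(\|x-\xi\|^2)$, where $\mathcal{O}(g)$ indicates a value bounded above by $g$ up to a positive constant. Deflation-one singular zero. $\xi$ is an isolated singular zero of $f$ if $f(\xi)=0$, $\xi$ is the only zero of $f$ in some ball around $\xi$, and $\kappa=\dim\ker Df(\xi)>0$. Let $[W_1,W_2]$ be an invertible $n\times n$ matrix with $W_1\in\mathbb{C}^{n\times(n-\kappa)}$, $\operatorname{im}W_1=(\ker Df(\xi))^\perp$, and $W_2\in\mathbb{C}^{n\times\kappa}$, $\operatorname{im}W_2=\ker Df(\xi)$. An isolated singular zero $\xi$ is a deflation-one singular zero if the $2n\times(2n-\kappa)$ matrix $\begin{bmatrix}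 Df(\xi)&\mathbf 0\\ D^2f(\xi)\cdot W_2\boldsymbol{\lambda}_2 & Df(\xi)W_1\end{bmatrix}$ has full column rank for almost all $\boldsymbol{\lambda}_2\in\mathbb{C}^\kappa$ (i.e. outside a proper algebraic subset). One iteration of the two-step Newton's method at $x$, with output $x''$: (1) Compute a singular value decomposition $Df(x)=U\Sigma V^*$ with $U,V$ unitary and singular values $\sigma_1\ge\cdots\ge\sigma_n\ge0$. Given a tolerance $\tau$ for the numerical rank, determine $n-\kappa$ as the largest $i$ with $\sigma_i>\tau$; it is assumed that $\tau$ is chosen so that this gives the true value $\kappa=\dim\ker Df(\xi)$. Partition $U=[U_1,U_2]$, $V=[V_1,V_2]$ with $U_2,V_2\in\mathbb{C}^{n\times\kappa}$, and put $\Sigma_1=\operatorname{diag}(\sigma_1,\ldots,\sigma_{n-\kappa})$. (2) Set $x'=x-V_1\Sigma_1^{-1}U_1^*f(x)$ (if $\kappa=n$, then $x'=x$). (3) Take a random sample $v\in\operatorname{im}V_2$ with $\|v\|=1$, construct the invertible $\kappa\times\kappa$ matrix $\mathcal{B}'=U_2^*\cdot D^2f(x')\cdot v\cdot V_2$, solve $\mathcal{B}'\cdot\boldsymbol{\delta}=-U_2^*\cdot Df(x')\cdot v$ for $\boldsymbol{\delta}\in\mathbb{C}^\kappa$, and set $x''=x'+V_2\cdot\boldsymbol{\delta}$.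
   Formalization: The random samples v are required to stay at distance at least d>0 from a fixed proper algebraic subset of ker Df(ξ), and the O-constant and ''sufficiently small'' depend on d; for κ≥2 no single constant works for all v with B' invertible. *)

(* Defs.v *)
(* MathComp / MathComp-Analysis; complex numbers are R[i] for R : realType. *)
From mathcomp Require Import all_boot all_order all_algebra spectral complex.
From mathcomp Require Import all_classical reals topology normedtype sequences.
(* Not imported: its notations clash with those of MathComp-Analysis. *)
From mathcomp Require mpoly.

Set Implicit Arguments.
Unset Strict Implicit.
Unset Printing Implicit Defensive.

Import Order.TTheory GRing.Theory Num.Theory.
Import numFieldNormedType.Exports.

Local Open Scope classical_set_scope.
Local Open Scope ring_scope.
Local Open Scope complex_scope.
Local Open Scope sesquilinear_scope.

Section Generalities.
Variable R : realType.
Local Notation C := R[i].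

Definition enorm n (u : 'cV[C]_n) : R :=
  Num.sqrt (\sum_i (complex.Re (u i 0) ^+ 2 + complex.Im (u i 0) ^+ 2)).

Definition ker m n (A : 'M[C]_(m, n)) : set 'cV[C]_n := [set u | A *m u = 0].

(* [cokermx A] spans the column vectors [u] such that [A *m u = 0] ([kermx] is
   about row vectors). *)
Definition ker_dim m n (A : 'M[C]_(m, n)) : nat := \rank (cokermx A).

Lemma ker_dim_le m n (A : 'M[C]_(m, n)) : (ker_dim A <= n)%N.
Proof. exact: rank_leq_row. Qed.

Definition im m n (A : 'M[C]_(m, n)) : set 'cV[C]_m := range (mulmx A).

Definition orthogonal_compl n (L : set 'cV[C]_n) : set 'cV[C]_n :=
  [set u | forall w, L w -> w^t* *m u = 0].

Definition algebraic_set n (Z : set 'cV[C]_n) : Prop :=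
  exists F : set (mpoly.mpoly n C),
    Z = [set u | forall p, F p -> mpoly.meval (fun i => u i 0) p = 0].

(* "For almost all u in L", where L is a linear subspace. *)
Definition almost_all_in n (L P : set 'cV[C]_n) : Prop :=
  exists Z, [/\ algebraic_set Z, Z `<` L & forall u, L u -> ~ Z u -> P u].

(* For k <= n, a matrix with n columns is partitioned into its first n - k and
   its last k columns. *)
Definition head_cols n k (le_kn : (k <= n)%N) m (A : 'M[C]_(m, n)) :
    'M[C]_(m, n - k) :=
  colsub (fun j => cast_ord (subnK le_kn) (lshift k j)) A.

Definition last_cols n k (le_kn : (k <= n)%N) m (A : 'M[C]_(m, n)) :
    'M[C]_(m, k) :=
  colsub (fun j => cast_ord (subnK le_kn) (rshift (n - k) j)) A.

Definition sigma_row n (s : 'rV[R]_n) : 'rV[C]_n := map_mx (fun t => t%:C) s.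

Definition is_svd n (A U V : 'M[C]_n) (s : 'rV[R]_n) : Prop :=
  [/\ U \is unitarymx, V \is unitarymx,
      forall i j : 'I_n, (i <= j)%N -> s 0 j <= s 0 i,
      forall i, 0 <= s 0 i
    & A = U *m diag_mx (sigma_row s) *m V^t*].

(* The largest 1-based index i with sigma_i > tau, and 0 if there is none. *)
Definition numerical_rank n (s : 'rV[R]_n) (tau : R) : nat :=
  (\max_(i < n | (tau < s 0%R i)%R) i.+1)%N.

End Generalities.

Section PolynomialSystems.
Variables (R : realType) (n : nat).
Local Notation C := R[i].

Definition polysys := 'I_n -> mpoly.mpoly n C.

Variable f : polysys.

Definition evalsys (x : 'cV[C]_n) : 'cV[C]_n :=
  \col_i mpoly.meval (fun j => x j 0) (f i).

Definition jacobian (x : 'cV[C]_n) : 'M[C]_n :=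
  \matrix_(i, j) mpoly.meval (fun l => x l 0) (mpoly.mderiv j (f i)).

Definition hessian_dir (x u : 'cV[C]_n) : 'M[C]_n :=
  \matrix_(i, j) \sum_k
    mpoly.meval (fun l => x l 0) (mpoly.mderiv k (mpoly.mderiv j (f i)))
      * u k 0.

Definition isolated_singular_zero (xi : 'cV[C]_n) : Prop :=
  [/\ evalsys xi = 0,
      exists2 r : R, 0 < r &
        forall y, enorm (y - xi) < r -> evalsys y = 0 -> y = xi
    & (0 < ker_dim (jacobian xi))%N].

(* The matrix [W1, W2] has n - k + k columns, which is n only up to a cast:
   its invertibility is stated as row_free together with row_full. *)
Definition deflation_one_singular_zero (xi : 'cV[C]_n) : Prop :=
  let A := jacobian xi in
  let k := ker_dim A in
  isolated_singular_zero xi /\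
  exists (W1 : 'M[C]_(n, n - k)) (W2 : 'M[C]_(n, k)),
    [/\ row_free (row_mx W1 W2) && row_full (row_mx W1 W2),
        im W1 = orthogonal_compl (ker A),
        im W2 = ker A
      & almost_all_in [set: 'cV[C]_k] [set lambda |
          \rank (block_mx A 0 (hessian_dir xi (W2 *m lambda)) (A *m W1))
            = (n + (n - k))%N]].

Section TwoStepNewton.
Variables (k : nat) (le_kn : (k <= n)%N).

Definition svd_with_corank (x : 'cV[C]_n) (U V : 'M[C]_n) (s : 'rV[R]_n)
    (tau : R) : Prop :=
  is_svd (jacobian x) U V s /\ (n - k)%N = numerical_rank s tau.

Definition first_step (x : 'cV[C]_n) (U V : 'M[C]_n) (s : 'rV[R]_n) :
    'cV[C]_n :=
  x - head_cols le_kn V *m invmx (diag_mx (head_cols le_kn (sigma_row s)))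
        *m (head_cols le_kn U)^t* *m evalsys x.

(* The matrix B' of the second step, with x' the result of the first one. *)
Definition second_step_mx (x' : 'cV[C]_n) (U V : 'M[C]_n) (v : 'cV[C]_n) :
    'M[C]_k :=
  (last_cols le_kn U)^t* *m hessian_dir x' v *m last_cols le_kn V.

Definition unit_sample (V : 'M[C]_n) (v : 'cV[C]_n) : Prop :=
  im (last_cols le_kn V) v /\ enorm v = 1.

(* One iteration from x with sample v may output x''.  This is a relation: the
   decomposition and the tolerance are not determined by x. *)
Definition two_step_newton (x v x'' : 'cV[C]_n) : Prop :=
  exists (U V : 'M[C]_n) (s : 'rV[R]_n) (tau : R) (delta : 'cV[C]_k),
    let x' := first_step x U V s in
    let B := second_step_mx x' U V v in
    [/\ svd_with_corank x U V s tau, unit_sample V v, B \in unitmx,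
        B *m delta = - ((last_cols le_kn U)^t* *m jacobian x' *m v)
      & x'' = x' + last_cols le_kn V *m delta].

End TwoStepNewton.
End PolynomialSystems.

Definition at_distance (R : realType) n (d : R) (Z : set 'cV[R[i]]_n)
    (v : 'cV[R[i]]_n) : Prop :=
  forall z, Z z -> d <= enorm (v - z).

(* Main.v *)
Require Import Defs.
From mathcomp Require mpoly.
Import -(notations) mpoly.
From mathcomp Require Import all_boot all_order all_algebra perm.
From mathcomp Require Import spectral complex.
From mathcomp Require Import all_classical reals topology normedtype sequences.
From mathcomp Require Import ring lra.

Set Implicit Arguments.
Unset Strict Implicit.
Unset Printing Implicit Defensive.

Import Order.TTheory GRing.Theory Num.Theory.
Import numFieldNormedType.Exports.

Local Open Scope classical_set_scope.
Local Open Scope ring_scope.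
Local Open Scope complex_scope.
Local Open Scope sesquilinear_scope.

Local Notation normc := Normc.normc.

(** Why the iteration converges quadratically.

Write A0 for the Jacobian matrix at xi, e = x - xi, X^H for the conjugate
transpose of X, and let N (resp. L) have the kernel of A0 as column space
(resp. the left kernel as row space).  All estimates below are uniform in x and
in the chosen singular value decomposition.

Since A0 has rank n - k, a dimension count shows that near xi the last k
singular values of Df(x) are O(|e|) while the others are bounded below
([svd_small], [svd_large]).  As f(x) = Df(x) e + O(|e|^2), the first step
removes the component of e along V1 and leaves x' - xi = V2 a + O(|e|^2) with
a = V2^H e ([isO_first_step]).

The second step is a Newton step for y |-> U2^H Df(y) v restricted to the
directions V2, whose derivative there is B'.  A Taylor expansion gives
U2^H Df(x') v = U2^H A0 v + B' a + O(|e|^2).  The first term is harmless: U2^H A0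
and A0 V2 are both O(|e|), and A0 = A0 G A0 for a fixed generalized inverse G,
so that U2^H A0 V2 = (U2^H A0) G (A0 V2) is O(|e|^2) ([isO_U2A0V2]).  Hence
B' (delta + a) = O(|e|^2), and x'' - xi = V2 (delta + a) + O(|e|^2) is O(|e|^2)
as soon as the inverse of B' is bounded ([isO_newton_step]).

To bound it, let w be the projection of v to the kernel of A0; then B' is
close, up to a change of bases, to the matrix M_w = L (D^2 f(xi) w) N, in the
sense that V2^H N M_w^-1 L U2 is an approximate left inverse of B'
([approx_invE], [isO_defect]).  That xi is a deflation-one zero means that M_u
is invertible for some u in the kernel ([nondegenerate_direction]), so that the
vectors w of the kernel with det M_w = 0 form a proper algebraic subset Z.  When
w is at distance at least rho from Z, an explicit bound replaces a compactness
argument: t |-> det (M_w + t M_u) is a polynomial of degree k with leading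
coefficient det M_u, and at each of its roots w + t u lies in Z, so that
|t| >= rho / |u|; hence |det M_w| >= |det M_u| (rho / |u|)^k
([det_pencil_lower], [degenerate_inv_bound]).

The same comparison with w = u and v = V2 V2^H u shows that B' is invertible
for at least one v in the image of V2, hence for almost all of them
([generic_sample_unit]). *)

(** * Norms *)
Section Norm.
Variable R : realType.
Local Notation C := R[i].

Lemma normc_ge0 (z : C) : 0 <= normc z.
Proof. by case: z => a b; rewrite sqrtr_ge0. Qed.

Lemma normc_triangle (y z : C) : normc (y + z) <= normc y + normc z.
Proof. exact: (@le_normcD R y z). Qed.

Lemma normc_opp (z : C) : normc (- z) = normc z.
Proof. exact: (@normcN R z). Qed.

Lemma normc_conj (z : C) : normc z^* = normc z.
Proof. by case: z => a b /=; rewrite sqrrN. Qed.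

Lemma normc_sum (I : Type) (r : seq I) (P : pred I) (F : I -> C) :
  normc (\sum_(i <- r | P i) F i) <= \sum_(i <- r | P i) normc (F i).
Proof.
elim/big_rec2: _ => [|i y z _ le_zy]; first by rewrite Normc.normc0.
by apply: (le_trans (normc_triangle _ _)); rewrite lerD2l.
Qed.

Lemma normc_prod (I : Type) (r : seq I) (P : pred I) (F : I -> C) :
  normc (\prod_(i <- r | P i) F i) = \prod_(i <- r | P i) normc (F i).
Proof. by apply: big_morph; [exact: Normc.normcM | exact: Normc.normc1]. Qed.

Lemma normc_real (a : R) : normc a%:C = `|a|.
Proof. by rewrite /= expr0n addr0 sqrtr_sqr. Qed.

(** The entrywise l1 norm: submultiplicative for all shapes without the
Cauchy-Schwarz inequality, and equivalent to [enorm] on column vectors, which is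
enough for estimates up to a constant. *)
Definition nrm m n (M : 'M[C]_(m, n)) : R := \sum_i \sum_j normc (M i j).

Lemma nrm_ge0 m n (M : 'M[C]_(m, n)) : 0 <= nrm M.
Proof. by do 2![apply: sumr_ge0 => ? _]; exact: normc_ge0. Qed.

Lemma normc_le_nrm m n (M : 'M[C]_(m, n)) i j : normc (M i j) <= nrm M.
Proof.
rewrite /nrm (bigD1 i) //= (bigD1 j) //= -addrA lerDl addr_ge0 //.
  by apply: sumr_ge0 => ? _; exact: normc_ge0.
by do 2![apply: sumr_ge0 => ? _]; exact: normc_ge0.
Qed.

Lemma nrm0 m n : nrm (0 : 'M[C]_(m, n)) = 0.
Proof. by do 2![apply: big1 => ? _]; rewrite mxE Normc.normc0. Qed.

Lemma nrm_eq0 m n (M : 'M[C]_(m, n)) : nrm M <= 0 -> M = 0.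
Proof.
move=> M0; apply/matrixP => i j; rewrite mxE; apply: Normc.eq0_normc.
by apply/le_anti; rewrite normc_ge0 (le_trans (normc_le_nrm M i j)).
Qed.

Lemma nrmN m n (M : 'M[C]_(m, n)) : nrm (- M) = nrm M.
Proof. by do 2![apply: eq_bigr => ? _]; rewrite mxE normc_opp. Qed.

Lemma nrmD m n (M N : 'M[C]_(m, n)) : nrm (M + N) <= nrm M + nrm N.
Proof.
rewrite /nrm -big_split; apply: ler_sum => i _.
rewrite -big_split; apply: ler_sum => j _.
by rewrite mxE normc_triangle.
Qed.

Lemma nrmB m n (M N : 'M[C]_(m, n)) : nrm (M - N) <= nrm M + nrm N.
Proof. by rewrite (le_trans (nrmD _ _)) // nrmN. Qed.

Lemma nrmM m n p (M : 'M[C]_(m, n)) (N : 'M[C]_(n, p)) :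
  nrm (M *m N) <= nrm M * nrm N.
Proof.
rewrite /nrm mulr_suml; apply: ler_sum => i _.
under eq_bigr do rewrite mxE.
apply: (@le_trans _ _ (\sum_k \sum_j normc (M i j) * normc (N j k))).
  apply: ler_sum => k _; apply: (le_trans (normc_sum _ _ _)).
  by apply: ler_sum => j _; rewrite Normc.normcM.
rewrite exchange_big mulr_suml /=; apply: ler_sum => j _.
rewrite -mulr_sumr ler_wpM2l ?normc_ge0 // (bigD1 j) //= lerDl.
by do 2![apply: sumr_ge0 => ? _]; exact: normc_ge0.
Qed.

Lemma nrm_ct m n (M : 'M[C]_(m, n)) : nrm (M^t*) = nrm M.
Proof.
rewrite /nrm exchange_big; do 2![apply: eq_bigr => ? _].
by rewrite !mxE normc_conj.
Qed.

Lemma nrm_le_entries m n (M : 'M[C]_(m, n)) b :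
  (forall i j, normc (M i j) <= b) -> nrm M <= b *+ n *+ m.
Proof.
move=> leb; rewrite -[m in leRHS]card_ord -sumr_const.
apply: ler_sum => i _; rewrite -[n in leRHS]card_ord -sumr_const.
exact: ler_sum.
Qed.

Lemma nrmZ (a : C) m n (M : 'M[C]_(m, n)) : nrm (a *: M) = normc a * nrm M.
Proof.
rewrite /nrm !mulr_sumr; apply: eq_bigr => i _; rewrite mulr_sumr.
by apply: eq_bigr => j _; rewrite mxE Normc.normcM.
Qed.

Lemma nrm_sum m l (I : Type) (r : seq I) (F : I -> 'M[C]_(m, l)) :
  nrm (\sum_(i <- r) F i) <= \sum_(i <- r) nrm (F i).
Proof.
elim/big_rec2: _ => [|i y z _ le_zy]; first by rewrite nrm0.
by apply: (le_trans (nrmD _ _)); rewrite lerD2l.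
Qed.

Lemma enorm_ge0 n (u : 'cV[C]_n) : 0 <= enorm u.
Proof. exact: sqrtr_ge0. Qed.

Lemma enorm_le_nrm n (u : 'cV[C]_n) : enorm u <= nrm u.
Proof.
rewrite -(ger0_norm (nrm_ge0 u)) -sqrtr_sqr ler_wsqrtr //.
rewrite /nrm; under [in leRHS]eq_bigr do rewrite big_ord1.
have -> : \sum_i (complex.Re (u i 0) ^+ 2 + complex.Im (u i 0) ^+ 2) =
   \sum_i normc (u i 0) ^+ 2.
  apply: eq_bigr => i _; case: (u i 0) => a b /=.
  by rewrite sqr_sqrtr ?addr_ge0 ?sqr_ge0.
rewrite [leRHS]expr2 mulr_suml; apply: ler_sum => i _.
rewrite expr2 ler_wpM2l ?normc_ge0 // (bigD1 i) //= lerDl.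
by apply: sumr_ge0 => ? _; exact: normc_ge0.
Qed.

Lemma nrm_le_enorm n (u : 'cV[C]_n) : nrm u <= n%:R * enorm u.
Proof.
rewrite mulrC mulr_natr; apply: (@nrm_le_entries n 1) => i j.
rewrite (ord1 j); case Eu: (u i 0) => [a b] /=; apply: ler_wsqrtr.
rewrite (bigD1 i) //= Eu /= lerDl; apply: sumr_ge0 => ? _.
by rewrite addr_ge0 ?sqr_ge0.
Qed.

(** The operator 1 + E is bounded below when E is small, so an estimate of
(1 + E) F yields one of F. *)
Lemma nrm_absorb m n (E : 'M[C]_m) (F : 'M[C]_(m, n)) :
  nrm E <= 2^-1 -> nrm F <= 2 * nrm (F + E *m F).
Proof.
move=> E12.
have := nrmB (F + E *m F) (E *m F); rewrite addrK.
have := nrmM E F; have := ler_wpM2r (nrm_ge0 F) E12; lra.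
Qed.

End Norm.

(** * Uniform big-O estimates for families of matrices *)
Section BigO.
Variables (R : realType) (T : Type) (eps : T -> R).
Hypothesis eps_ge0 : forall t, 0 <= eps t.
Local Notation C := R[i].

(** The family F, indexed by an arbitrary type T, is O(eps^p) as eps tends to 0,
uniformly in the index: the constant cannot depend on anything that T carries,
such as a singular value decomposition or a sample vector. *)
Definition isO m n (F : T -> 'M[C]_(m, n)) (p : nat) : Prop :=
  exists c d, [/\ 0 <= c, 0 < d & forall t, eps t < d ->
                nrm (F t) <= c * eps t ^+ p].

Lemma isO_weaken m n (F : T -> 'M[C]_(m, n)) p q :
  (q <= p)%N -> isO F p -> isO F q.
Proof.
move=> qp [c [d [c0 d0 H]]]; exists c, (Num.min d 1); split=> //.
  by rewrite lt_min d0 ltr01.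
move=> t; rewrite lt_min => /andP[td t1]; apply: (le_trans (H t td)).
by rewrite ler_wpM2l // ler_wiXn2l // ltW.
Qed.

Lemma isO_eq m n (F G : T -> 'M[C]_(m, n)) p : F =1 G -> isO F p -> isO G p.
Proof. by move=> /funext ->. Qed.

Lemma isO_le m n m' n' (F : T -> 'M[C]_(m, n)) (G : T -> 'M[C]_(m', n')) p a :
  0 <= a -> (forall t, nrm (G t) <= a * nrm (F t)) -> isO F p -> isO G p.
Proof.
move=> a0 FG [c [d [c0 d0 H]]]; exists (a * c), d; split=> //.
  exact: mulr_ge0.
by move=> t td; rewrite (le_trans (FG t)) // -mulrA ler_wpM2l // H.
Qed.

Lemma isO_cst m n (M : 'M[C]_(m, n)) : isO (fun=> M) 0.
Proof.
by exists (nrm M), 1; split=> // [|t _]; rewrite ?nrm_ge0 ?expr0 ?mulr1.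
Qed.

Lemma isO_bounded m n (F : T -> 'M[C]_(m, n)) b :
  (forall t, nrm (F t) <= b) -> isO F 0.
Proof.
move=> Fb; exists (`|b|), 1; split=> // t _.
by rewrite expr0 mulr1 (le_trans (Fb t)) // ler_norm.
Qed.

Lemma isO_ct m n (F : T -> 'M[C]_(m, n)) p :
  isO F p -> isO (fun t => (F t)^t*) p.
Proof. by apply: (@isO_le _ _ _ _ _ _ _ 1) => // t; rewrite nrm_ct mul1r. Qed.

Lemma isON m n (F : T -> 'M[C]_(m, n)) p : isO F p -> isO (fun t => - F t) p.
Proof. by apply: (@isO_le _ _ _ _ _ _ _ 1) => // t; rewrite nrmN mul1r. Qed.

Lemma isOD m n (F G : T -> 'M[C]_(m, n)) p :
  isO F p -> isO G p -> isO (fun t => F t + G t) p.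
Proof.
move=> [c [d [c0 d0 H]]] [c' [d' [c0' d0' H']]].
exists (c + c'), (Num.min d d'); split; first exact: addr_ge0.
  by rewrite lt_min d0 d0'.
move=> t; rewrite lt_min => /andP[td td']; rewrite (le_trans (nrmD _ _)) //.
by rewrite mulrDl lerD ?H ?H'.
Qed.

Lemma isOB m n (F G : T -> 'M[C]_(m, n)) p :
  isO F p -> isO G p -> isO (fun t => F t - G t) p.
Proof. by move=> OF OG; apply: isOD => //; exact: isON. Qed.

Lemma isOM m n l (F : T -> 'M[C]_(m, n)) (G : T -> 'M[C]_(n, l)) p q :
  isO F p -> isO G q -> isO (fun t => F t *m G t) (p + q).
Proof.
move=> [c [d [c0 d0 H]]] [c' [d' [c0' d0' H']]].
exists (c * c'), (Num.min d d'); split; first exact: mulr_ge0.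
  by rewrite lt_min d0 d0'.
move=> t; rewrite lt_min => /andP[td td']; rewrite (le_trans (nrmM _ _)) //.
by rewrite exprD mulrACA ler_pM ?nrm_ge0 ?H ?H'.
Qed.

Lemma isO_lt m n (F : T -> 'M[C]_(m, n)) a : 0 < a -> isO F 1 ->
  exists2 d, 0 < d & forall t, eps t < d -> nrm (F t) < a.
Proof.
move=> a0 [c [d [c0 d0 H]]]; exists (Num.min d (a / (c + 1))).
  by rewrite lt_min d0 divr_gt0 // ltr_wpDl.
move=> t; rewrite lt_min ltr_pdivlMr ?ltr_wpDl // => /andP[td ta].
have := H t td; rewrite expr1 => Ht; have := eps_ge0 t; lra.
Qed.

Lemma isO_absorb m n (E : T -> 'M[C]_m) (F : T -> 'M[C]_(m, n)) p :
  isO E 1 -> isO (fun t => F t + E t *m F t) p -> isO F p.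
Proof.
move=> /(@isO_lt _ _ _ 2^-1)[|d d0 H]; first by rewrite invr_gt0.
move=> [c [d' [c0 d0' H']]].
exists (2 * c), (Num.min d d'); split; first by rewrite mulr_ge0.
  by rewrite lt_min d0 d0'.
move=> t; rewrite lt_min => /andP[/H/ltW/(nrm_absorb (F t))/le_trans + /H' td'].
by apply; rewrite -mulrA ler_wpM2l.
Qed.

(** Reduces an estimate to 1x1 matrices, where it follows from a statement about
one polynomial. *)
Lemma isO_entries m n (F : T -> 'M[C]_(m, n)) p :
  (forall i j, isO (fun t => (F t i j)%:M : 'M_1) p) -> isO F p.
Proof.
move=> H.
have {}H i j : exists cd : R * R, [/\ 0 <= cd.1, 0 < cd.2 & forall t,
    eps t < cd.2 -> normc (F t i j) <= cd.1 * eps t ^+ p].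
  have [c [d [c0 d0 Ht]]] := H i j; exists (c, d); split=> // t /Ht.
  by apply: le_trans; have := normc_le_nrm ((F t i j)%:M : 'M_1) 0 0; rewrite mxE eqxx.
have [cd Hcd] := choice (fun ij : 'I_m * 'I_n => H ij.1 ij.2).
exists (\sum_i \sum_j (cd (i, j)).1), (\big[Num.min/1]_ij (cd ij).2); split.
- by apply: sumr_ge0 => i _; apply: sumr_ge0 => j _; have [] := Hcd (i, j).
- by apply: lt_bigmin => // ij _; have [] := Hcd ij.
move=> t td; rewrite mulr_suml; apply: ler_sum => i _.
rewrite mulr_suml; apply: ler_sum => j _.
have [_ _] := Hcd (i, j); apply.
by apply: lt_le_trans td _; exact: bigmin_le_cond.
Qed.

Lemma isO_sum m l (I : Type) (r : seq I) (F : I -> T -> 'M[C]_(m, l)) p :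
  (forall i, isO (F i) p) -> isO (fun t => \sum_(i <- r) F i t) p.
Proof.
move=> H; elim: r => [|a r IH].
  exists 0, 1; split=> // t _; rewrite big_nil nrm0 mul0r //.
by apply: isO_eq (isOD (H a) IH) => t; rewrite big_cons.
Qed.

Lemma isO_entry m l (F : T -> 'M[C]_(m, l)) p i j :
  isO F p -> isO (fun t => (F t i j)%:M : 'M_1) p.
Proof.
apply: (@isO_le _ _ _ _ _ _ _ 1) => // t.
by rewrite {1}/nrm !big_ord1 mxE eqxx mul1r normc_le_nrm.
Qed.

(** Identities that hold only close to the limit, where a matrix is invertible,
are as good as global ones. *)
Lemma isO_near m l (F H : T -> 'M[C]_(m, l)) p d :
  0 < d -> (forall t, eps t < d -> F t = H t) -> isO F p -> isO H p.
Proof.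
move=> d0 FH [c [d' [c0 d0' Hd]]]; exists c, (Num.min d d'); split=> //.
  by rewrite lt_min d0 d0'.
by move=> t; rewrite lt_min => /andP[td td']; rewrite -FH // Hd.
Qed.

End BigO.

(** * Taylor expansion of polynomials at a zero *)
Section Taylor.
Variables (R : realType) (n : nat) (xi : 'cV[R[i]]_n).
Local Notation C := R[i].

Definition peval (p : mpoly n C) (x : 'cV[C]_n) : C :=
  meval (fun i => x i 0) p.

Definition pdiff (p : mpoly n C) (x h : 'cV[C]_n) : C :=
  \sum_j peval (mderiv j p) x * h j 0.

(** The derivative is taken at x rather than at the base point xi, which is the
form needed by Newton's method; the bounds hold in the unit ball only because
polynomials are not globally Lipschitz. *)
Definition taylor_bounded (p : mpoly n C) : Prop :=
  exists2 c : R, 0 <= c & forall x, nrm (x - xi) <= 1 ->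
    normc (peval p x - peval p xi) <= c * nrm (x - xi) /\
    normc (peval p x - peval p xi - pdiff p x (x - xi))
      <= c * nrm (x - xi) ^+ 2.

Lemma taylor_boundedC (a : C) : taylor_bounded (mpolyC n a).
Proof.
exists 0 => // x _; rewrite /pdiff /peval !mevalC subrr big1 ?subrr => [|j _].
  by rewrite Normc.normc0 !mul0r.
by rewrite mderivC meval0 mul0r.
Qed.

Lemma taylor_boundedX i : taylor_bounded (mpolyX _ (mnm1 i)).
Proof.
exists 1 => // x _.
have -> : pdiff (mpolyX _ (mnm1 i)) x (x - xi) = x i 0 - xi i 0.
  rewrite /pdiff (bigD1 i) //= big1 ?addr0 => [|j ji].
    rewrite /peval mderivX mevalZ mnm1E eqxx mul1r mevalX big1 ?mul1r ?mxE //.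
    by move=> j _; rewrite mnmBE subnn expr0.
  by rewrite mderivX mnm1E eq_sym (negPf ji) scale0r /peval meval0 mul0r.
rewrite /peval !mevalXU subrr Normc.normc0 !mul1r sqr_ge0; split=> //.
by have := normc_le_nrm (x - xi) i 0; rewrite !mxE.
Qed.

Lemma taylor_boundedD p q :
  taylor_bounded p -> taylor_bounded q -> taylor_bounded (p + q).
Proof.
move=> [c c0 P] [d d0 Q]; exists (c + d); first exact: addr_ge0.
move=> x x1; have [P1 P2] := P x x1; have [Q1 Q2] := Q x x1.
have -> : pdiff (p + q) x (x - xi) = pdiff p x (x - xi) + pdiff q x (x - xi).
  rewrite /pdiff -big_split; apply: eq_bigr => j _.
  by rewrite /peval mderivD mevalD mulrDl.
have pqE z : peval (p + q) z = peval p z + peval q z by exact: mevalD.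
rewrite !mulrDl !pqE; split.
  by rewrite opprD addrACA (le_trans (normc_triangle _ _)) // lerD.
set a := peval p x; set b := peval q x; set a0 := peval p xi.
set b0 := peval q xi; set da := pdiff p _ _; set db := pdiff q _ _.
have -> : a + b - (a0 + b0) - (da + db) = (a - a0 - da) + (b - b0 - db) by ring.
by rewrite (le_trans (normc_triangle _ _)) // lerD.
Qed.

(** If R_p and R_q are the remainders of p and q, and p0, q0 their values at xi,
then the remainder of pq is q R_p + p R_q - (p - p0) (q - q0). *)
Lemma taylor_boundedM p q :
  taylor_bounded p -> taylor_bounded q -> taylor_bounded (p * q).
Proof.
move=> [c c0 P] [d d0 Q].
set a := normc (peval p xi) + c; set b := normc (peval q xi) + d.
exists (b * c + a * d + c * d).
  by rewrite !addr_ge0 ?mulr_ge0 ?addr_ge0 ?normc_ge0.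
move=> x x1; have [P1 P2] := P x x1; have [Q1 Q2] := Q x x1.
have -> : pdiff (p * q) x (x - xi) =
    peval q x * pdiff p x (x - xi) + peval p x * pdiff q x (x - xi).
  rewrite /pdiff !mulr_sumr -big_split; apply: eq_bigr => j _ /=.
  rewrite /peval mderivM mevalD !mevalM mulrDl.
  by congr (_ + _); [rewrite mulrAC mulrC | rewrite mulrA].
have pqE z : peval (p * q) z = peval p z * peval q z by exact: mevalM.
rewrite !pqE.
move: (pdiff p _ _) (pdiff q _ _) P1 P2 Q1 Q2 => dp dq.
move: (peval p x) (peval q x) => px qx P1 P2 Q1 Q2.
set p0 := peval p xi in a P1 P2 *; set q0 := peval q xi in b Q1 Q2 *.
have e0 := nrm_ge0 (x - xi); move: (nrm _) => e in x1 e0 P1 P2 Q1 Q2 *.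
have pa : normc px <= a.
  rewrite -[px](subrK p0) addrC (le_trans (normc_triangle _ _)) // lerD2l.
  by rewrite (le_trans P1) // ler_piMr.
have qb : normc qx <= b.
  rewrite -[qx](subrK q0) addrC (le_trans (normc_triangle _ _)) // lerD2l.
  by rewrite (le_trans Q1) // ler_piMr.
have a0 : 0 <= a by rewrite addr_ge0 ?normc_ge0.
have b0 : 0 <= b by rewrite addr_ge0 ?normc_ge0.
have p0a : normc p0 <= a by rewrite lerDl.
move: a b => a b in a0 b0 pa qb p0a *.
split.
  have -> : px * qx - p0 * q0 = qx * (px - p0) + p0 * (qx - q0) by ring.
  rewrite (le_trans (normc_triangle _ _)) // !Normc.normcM.
  rewrite [leRHS]mulrDl [X in _ <= X + _]mulrDl.
  apply: ler_wpDr; first by rewrite !mulr_ge0.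
  by rewrite -!mulrA; apply: lerD; apply: ler_pM; rewrite ?normc_ge0.
have -> : px * qx - p0 * q0 - (qx * dp + px * dq) =
    qx * (px - p0 - dp) + px * (qx - q0 - dq) - (px - p0) * (qx - q0) by ring.
rewrite (le_trans (normc_triangle _ _)) // normc_opp [leRHS]mulrDl lerD //.
  rewrite (le_trans (normc_triangle _ _)) // !Normc.normcM [leRHS]mulrDl.
  rewrite -!mulrA.
  by apply: lerD; apply: ler_pM; rewrite ?normc_ge0.
by rewrite Normc.normcM expr2 mulrACA ler_pM ?normc_ge0.
Qed.

Lemma taylor (p : mpoly n C) : taylor_bounded p.
Proof.
move: p; have C0 : taylor_bounded 0 by have := taylor_boundedC 0; rewrite mpolyC0.
have C1 : taylor_bounded 1 by have := taylor_boundedC 1; rewrite mpolyC1.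
apply: mpolyind => [|a m q _ _ Tq]; first exact: C0.
apply: taylor_boundedD Tq.
rewrite -mul_mpolyC; apply: taylor_boundedM; first exact: taylor_boundedC.
rewrite mpolyXE_id; apply: big_ind => [|r1 r2|i _].
- exact: C1.
- exact: taylor_boundedM.
elim: (m i) => [|l IH]; first by rewrite expr0.
by rewrite exprS; apply: taylor_boundedM IH; exact: taylor_boundedX.
Qed.

Section Families.
Variables (T : Type) (eps : T -> R).
Hypothesis eps_ge0 : forall t, 0 <= eps t.
Variable y : T -> 'cV[C]_n.
Hypothesis Oy : isO eps (fun t => y t - xi) 1.

Lemma isO_peval p :
  isO eps (fun t => (peval p (y t) - peval p xi)%:M : 'M_1) 1 /\
  isO eps (fun t => (peval p (y t) - peval p xi - pdiff p (y t) (y t - xi))%:M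
            : 'M_1) 2.
Proof.
have [c c0 H] := taylor p; have [d d0 Hd] := isO_lt eps_ge0 ltr01 Oy.
have [k [d' [k0 d0' Hk]]] := Oy.
have nrm1 (z : C) : nrm (z%:M : 'M_1) = normc z.
  by rewrite /nrm !big_ord1 mxE eqxx.
have m0 : 0 < Num.min d d' by rewrite lt_min d0 d0'.
have Hm t : eps t < Num.min d d' ->
    nrm (y t - xi) <= 1 /\ nrm (y t - xi) <= k * eps t.
  by rewrite lt_min => /andP[/Hd/ltW ? /Hk]; rewrite expr1.
split; [exists (c * k), (Num.min d d')|exists (c * k ^+ 2), (Num.min d d')];
  split=> //; rewrite ?mulr_ge0 ?exprn_ge0 // => t /Hm[/H[H1 H2] Hkt];
  rewrite nrm1.
  by rewrite expr1 (le_trans H1) // -mulrA ler_wpM2l.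
rewrite (le_trans H2) // -mulrA ler_wpM2l // -exprMn.
by rewrite ler_pXn2r ?nnegrE ?nrm_ge0 ?mulr_ge0.
Qed.

Variable f : polysys R n.

Lemma isO_jacobian : isO eps (fun t => jacobian f (y t) - jacobian f xi) 1.
Proof.
apply: isO_entries => // i j; apply: isO_eq (isO_peval (mderiv j (f i))).1 => t.
by rewrite !mxE.
Qed.

Lemma isO_evalsys : evalsys f xi = 0 ->
  isO eps (fun t => evalsys f (y t) - jacobian f (y t) *m (y t - xi)) 2.
Proof.
move=> fxi; apply: isO_entries => // i j.
apply: isO_eq (isO_peval (f i)).2 => t; rewrite !mxE.
have -> : peval (f i) xi = 0 by have /matrixP/(_ i 0) := fxi; rewrite !mxE.
congr (_%:M); rewrite subr0; congr (_ - _); apply: eq_bigr => l _.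
by rewrite !mxE (ord1 j).
Qed.

Variables (v w : T -> 'cV[C]_n).
Hypothesis Ov : isO eps v 0.

(** First-order expansion of the Jacobian matrix in the direction v: the second
derivatives commute, so D^2 f(y) v applied to y - xi is the derivative of
y |-> Df(y) v along y - xi. *)
Lemma isO_jacobian_taylor :
  isO eps (fun t => jacobian f (y t) *m v t - jacobian f xi *m v t
                   - hessian_dir f (y t) (v t) *m (y t - xi)) 2.
Proof.
apply: isO_entries => // i j.
have H k := isOM (isO_entry k 0 Ov) (isO_peval (mderiv k (f i))).2.
apply: isO_eq (isO_sum (index_enum 'I_n) H) => t.
under eq_bigr do rewrite -scalar_mxM.
rewrite -raddf_sum /=; congr (_%:M); rewrite (ord1 j) !mxE.
under [X in _ = _ - X]eq_bigr do rewrite mxE mulr_suml.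
rewrite exchange_big -!sumrB /=; apply: eq_bigr => k _.
rewrite !mxE !mulrBr /pdiff; congr (_ - _); first by rewrite ![v t k 0 * _]mulrC.
rewrite mulr_sumr; apply: eq_bigr => l _.
by rewrite mulrA [v t k 0 * _]mulrC mderiv_comm.
Qed.

Hypothesis Ovw : isO eps (fun t => v t - w t) 1.

Lemma isO_hessian :
  isO eps (fun t => hessian_dir f (y t) (v t) - hessian_dir f xi (w t)) 1.
Proof.
apply: isO_entries => // i j.
have H k : isO eps (fun t =>
    (peval (mderiv k (mderiv j (f i))) (y t) * v t k 0
     - peval (mderiv k (mderiv j (f i))) xi * w t k 0)%:M : 'M_1) 1.
  set q := mderiv _ _.
  have H1 := isOM (isO_entry k 0 Ov) (isO_peval q).1.
  have H2 := isOM (isO_cst eps ((peval q xi)%:M : 'M_1)) (isO_entry k 0 Ovw).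
  rewrite !add0n in H1 H2.
  apply: isO_eq (isOD H1 H2) => t; rewrite -!scalar_mxM -raddfD /=.
  by congr (_%:M); rewrite !mxE; ring.
apply: isO_eq (isO_sum (index_enum 'I_n) H) => t.
by rewrite -raddf_sum /=; congr (_%:M); rewrite !mxE -sumrB.
Qed.

End Families.
End Taylor.

(** * Kernels, generalized inverses and determinants *)
Section LinearAlgebra.
Variable F : fieldType.

Lemma unitmx_inj k (M : 'M[F]_k) :
  (forall z : 'cV_k, M *m z = 0 -> z = 0) -> M \in unitmx.
Proof.
move=> inj; rewrite -unitmx_tr -row_free_unit; apply: inj_row_free => v vM.
apply: trmx_inj; rewrite trmx0; apply: inj.
by rewrite -[M]trmxK -trmx_mul vM trmx0.
Qed.

(** A dimension count: the coordinate subspace of S is too large for X to be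
injective on it. *)
Lemma supported_kernel m n (X : 'M[F]_(m, n)) (S : {set 'I_n}) :
  (\rank X < #|S|)%N ->
  exists2 y : 'cV[F]_n,
    y != 0 & X *m y = 0 /\ forall i, i \notin S -> y i 0 = 0.
Proof.
move=> rXS; pose Y := colsub (fun j : 'I_#|S| => enum_val j) X.
have YE : Y = X *m colsub (fun j : 'I_#|S| => enum_val j) 1%:M.
  by rewrite mulmx_colsub mulmx1.
have : ~~ row_free Y^T.
  rewrite /row_free mxrank_tr neq_ltn (leq_ltn_trans _ rXS) //.
  by rewrite YE mxrankM_maxl.
rewrite -kermx_eq0 => /rowV0Pn[z /sub_kermxP zY z0].
pose J : 'M[F]_(n, #|S|) := colsub (fun j : 'I_#|S| => enum_val j) 1%:M.
exists (J *m z^T).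
  apply: contra z0 => /eqP Jz0; apply/eqP/matrixP => i j; rewrite (ord1 i) mxE.
  have /matrixP/(_ (enum_val j) 0) := Jz0; rewrite !mxE => <-.
  rewrite (bigD1 j) //= big1 => [|l lj]; first by rewrite !mxE eqxx mul1r addr0.
  by rewrite !mxE (inj_eq enum_val_inj) eq_sym (negPf lj) mul0r.
split.
  by rewrite mulmxA -YE; apply: trmx_inj; rewrite trmx_mul trmxK zY trmx0.
move=> i iS; rewrite mxE big1 // => j _; rewrite !mxE.
by case: eqP => [iE|_]; [rewrite iE enum_valP in iS|rewrite mul0r].
Qed.

Lemma rank_idempotent_compl n (e : 'M[F]_n) :
  e *m e = e -> \rank (1%:M - e) = (n - \rank e)%N.
Proof.
move=> ee; rewrite -mxrank_ker; apply/eqP; rewrite eqn_leq; apply/andP; split.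
  by apply/mxrankS/sub_kermxP; rewrite mulmxBl mul1mx ee subrr.
apply: mxrankS; apply/submxP; exists (kermx e).
by rewrite mulmxBr mulmx1 mulmx_ker subr0.
Qed.

Lemma idempotent_factor n k (e : 'M[F]_n) : e *m e = e -> \rank e = k ->
  exists (N : 'M_(n, k)) (M : 'M_(k, n)), e = N *m M /\ M *m N = 1%:M.
Proof.
move=> ee <-; exists (col_base e), (row_base e); rewrite mulmx_base; split=> //.
apply: (row_full_inj (col_base_full e)).
apply: (row_free_inj (row_base_free e)).
by rewrite /= mulmx1 -mulmxA -mulmxA mulmx_base mulmxA mulmx_base ee.
Qed.

(** With A G A = A, the matrices 1 - G A and 1 - A G are projections, onto the
kernel of A and along its image; N and L are the outer factors of their rank
factorizations. *)
Lemma generalized_inverse n k (A : 'M[F]_n) : \rank (cokermx A) = k ->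
  exists (G : 'M_n) (N P : 'M_(n, k)) (M L : 'M_(k, n)),
    [/\ A *m N = 0, L *m A = 0, 1%:M - G *m A = N *m M, M *m N = 1%:M
      & 1%:M - A *m G = P *m L].
Proof.
rewrite mxrank_coker => rA; pose G := pinvmx A.
have AGA : A *m G *m A = A by rewrite mulmxKpV.
have idem (e : 'M[F]_n) : e *m e = e -> (1%:M - e) *m (1%:M - e) = 1%:M - e.
  by move=> ee; rewrite mulmxBl mul1mx mulmxBr mulmx1 ee subrr subr0.
have GAi : G *m A *m (G *m A) = G *m A by rewrite -mulmxA (mulmxA A) AGA.
have AGi : A *m G *m (A *m G) = A *m G by rewrite mulmxA AGA.
have rGA : \rank (G *m A) = \rank A.
  apply/eqP; rewrite eqn_leq mxrankM_maxr /= -[in leqLHS]AGA -mulmxA.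
  by rewrite mxrankM_maxr.
have rAG : \rank (A *m G) = \rank A.
  by apply/eqP; rewrite eqn_leq mxrankM_maxl /= -[in leqLHS]AGA mxrankM_maxl.
have [|N [M [eNM MN]]] := @idempotent_factor n k (1%:M - G *m A) (idem _ GAi).
  by rewrite rank_idempotent_compl // rGA.
have [|P [L [ePL LP]]] := @idempotent_factor n k (1%:M - A *m G) (idem _ AGi).
  by rewrite rank_idempotent_compl // rAG.
exists G, N, P, M, L; split=> //.
  by rewrite -[N]mulmx1 -MN !mulmxA -[A *m N *m M]mulmxA -eNM mulmxBr mulmx1
    mulmxA AGA subrr mul0mx.
by rewrite -[L]mul1mx -LP -!mulmxA [P *m _]mulmxA -ePL mulmxBl mul1mx AGA subrr
  mulmx0.
Qed.

End LinearAlgebra.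

Section Pencil.
Variable R : realType.
Local Notation C := R[i].

Lemma horner_char_poly k (M : 'M[C]_k) z : (char_poly M).[z] = \det (z%:M - M).
Proof.
rewrite -horner_evalE -det_map_mx; congr (\det _); apply/matrixP => i j.
rewrite !mxE /= horner_evalE hornerD hornerN hornerC; congr (_ - _).
by case: eqP; rewrite ?hornerX ?horner0.
Qed.

(** The polynomial t |-> det (M + t N) has degree k and leading coefficient
det N, so its value at 0 is, up to sign, det N times the product of its
roots. *)
Lemma det_pencil_lower k (M N : 'M[C]_k) (rho : R) : N \in unitmx -> 0 <= rho ->
  (forall z, \det (M + z *: N) = 0 -> rho <= normc z) ->
  normc (\det N) * rho ^+ k <= normc (\det M).
Proof.
move=> Nu rho0 roots; pose A := - (invmx N *m M).
have detE z : \det (M + z *: N) = \det N * (char_poly A).[z].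
  rewrite horner_char_poly -det_mulmx; congr (\det _).
  by rewrite /A opprK mulmxDr mulmxA mulmxV // mul1mx mul_mx_scalar addrC.
have [r rE] := closed_field_poly_normal (char_poly A).
have sr : size r = k.
  apply/eqP; rewrite -eqSS -(size_char_poly A) rE (monicP (char_poly_monic A)).
  by rewrite scale1r size_prod_XsubC.
rewrite (monicP (char_poly_monic A)) scale1r in rE.
rewrite -[M]addr0 -(scale0r N) detE Normc.normcM ler_wpM2l ?normc_ge0 //.
rewrite rE horner_prod normc_prod.
have <- : \prod_(z <- r) rho = rho ^+ k.
  by rewrite big_const_seq count_predT iter_mulr_1 sr.
rewrite big_seq [leRHS]big_seq; apply: ler_prod => z zr; rewrite rho0 /=.
rewrite hornerXsubC sub0r normc_opp roots // detE.
suff /eqP -> : root (char_poly A) z by rewrite mulr0.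
by rewrite rE root_prod_XsubC.
Qed.

Lemma normc_det k (M : 'M[C]_k) b : (forall i j, normc (M i j) <= b) ->
  normc (\det M) <= b ^+ k *+ #|'S_k|.
Proof.
move=> Mb; rewrite /determinant (le_trans (normc_sum _ _ _)) //.
rewrite -sumr_const; apply: ler_sum => s _; rewrite Normc.normcM.
have -> : normc ((-1) ^+ s) = 1 :> R.
  by case: (odd_perm s); rewrite ?expr1 ?normc_opp Normc.normc1.
rewrite mul1r normc_prod -[k in b ^+ k]card_ord -prodr_const.
by apply: ler_prod => i _; rewrite normc_ge0 Mb.
Qed.

(** By Cramer's rule the entries of the inverse are cofactors, which are bounded
by a polynomial in the norm, divided by the determinant. *)
Lemma nrm_invmx k (b c : R) : 0 < c -> exists b' : R, forall M : 'M[C]_k,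
  nrm M <= b -> c <= normc (\det M) -> M \in unitmx /\ nrm (invmx M) <= b'.
Proof.
move=> c0; exists (c^-1 * (b ^+ k.-1 *+ #|'S_k.-1| *+ k *+ k)) => M Mb cM.
have dM0 : \det M != 0.
  by apply: contraTneq cM => ->; rewrite Normc.normc0 -ltNge.
have Mu : M \in unitmx by rewrite unitmxE unitfE.
split=> //; rewrite /invmx Mu nrmZ; apply: ler_pM; rewrite ?normc_ge0 ?nrm_ge0 //.
  by rewrite Normc.normcV lef_pV2 // posrE // (lt_le_trans c0).
apply: nrm_le_entries => i j; rewrite mxE /cofactor Normc.normcM.
have -> : normc ((-1) ^+ (j + i)) = 1 :> R.
  by rewrite -signr_odd; case: odd; rewrite ?expr1 ?normc_opp Normc.normc1.
rewrite mul1r; apply: normc_det => ? ?; rewrite !mxE.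
exact: le_trans (normc_le_nrm _ _ _) Mb.
Qed.

Lemma algebraic_ker_det n m k (D : 'M[C]_(m, n)) (H : 'I_n -> 'M[C]_k) :
  algebraic_set [set w : 'cV[C]_n |
    D *m w = 0 /\ \det (\sum_l w l 0 *: H l) = 0].
Proof.
pose lin (a : 'I_n -> C) : mpoly n C :=
  \sum_l mpolyC n (a l) * mpolyX _ (mnm1 l).
have linE a (w : 'cV[C]_n) :
    meval (fun i => w i 0) (lin a) = \sum_l a l * w l 0.
  by rewrite rmorph_sum; apply: eq_bigr => l _; rewrite rmorphM /= mevalC mevalXU.
pose q := \det (\matrix_(i, j) lin (fun l => H l i j)).
have qE (w : 'cV[C]_n) :
    meval (fun i => w i 0) q = \det (\sum_l w l 0 *: H l).
  rewrite -det_map_mx; congr (\det _); apply/matrixP => i j.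
  rewrite !mxE summxE; etransitivity; first exact: linE.
  apply: eq_bigr => l _.
  by rewrite !mxE mulrC.
exists [set p | (exists i, p = lin (D i)) \/ p = q]; apply/seteqP; split=> w /=.
  case=> Dw dw p [[i ->]|->]; last by rewrite qE.
  by have /matrixP/(_ i 0) := Dw; rewrite linE !mxE.
move=> H0; split; last by rewrite -qE H0 //; right.
apply/matrixP => i j; rewrite (ord1 j) !mxE -linE H0 //.
by left; exists i.
Qed.

Lemma nrm_invmx_diag m (s : 'rV[C]_m) c :
  0 < c -> (forall i, c <= normc (s 0 i)) ->
  diag_mx s \in unitmx /\ nrm (invmx (diag_mx s)) <= c^-1 *+ m *+ m.
Proof.
move=> c0 sc; have sn0 i : s 0 i != 0.
  by apply: contraTneq (sc i) => ->; rewrite Normc.normc0 -ltNge.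
pose s' : 'rV[C]_m := map_mx GRing.inv s.
have ss' : diag_mx s *m diag_mx s' = 1%:M.
  rewrite mulmx_diag; apply/matrixP => i j; rewrite !mxE.
  by case: eqP => [->|//]; rewrite divff.
have [su _] := mulmx1_unit ss'.
split=> //; have -> : invmx (diag_mx s) = diag_mx s'.
  by rewrite -[LHS]mulmx1 -ss' mulmxA mulVmx // mul1mx.
apply: nrm_le_entries => i j; rewrite !mxE; case: eqP => _; last first.
  by rewrite mulr0n Normc.normc0 invr_ge0 ltW.
by rewrite mulr1n Normc.normcV lef_pV2 // posrE // (lt_le_trans c0).
Qed.

End Pencil.

(** * Singular value decompositions *)
Section Columns.

Lemma widen_ord_inj m n (H : (m <= n)%N) : injective (widen_ord H).
Proof. by move=> a b /(congr1 val) e; exact: val_inj. Qed.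

Variable R : realType.
Local Notation C := R[i].

Lemma mulmx_ct m n p (A : 'M[C]_(m, n)) (B : 'M[C]_(n, p)) :
  (A *m B)^t* = B^t* *m A^t*.
Proof. by rewrite trmx_mul map_mxM. Qed.

Lemma unitary_ctmul n (U : 'M[C]_n) : U \is unitarymx -> U^t* *m U = 1%:M.
Proof. by move/unitarymxP/mulmx1C. Qed.

Lemma ct_real_diag n (s : 'rV[R]_n) :
  (diag_mx (sigma_row s))^t* = diag_mx (sigma_row s).
Proof.
apply/matrixP => i j; rewrite !mxE eq_sym.
case: (i =P j) => [->|_]; last by rewrite !mulr0n rmorph0.
by rewrite !mulr1n; exact: conjc_real.
Qed.

Lemma nrm_unitary n (U : 'M[C]_n) : U \is unitarymx -> nrm U <= 1 *+ n *+ n.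
Proof.
move=> /unitarymxP UU; apply: nrm_le_entries => i j.
have /(congr1 (fun M : 'M_n => complex.Re (M i i))) := UU.
rewrite !mxE eqxx raddf_sum /= => H.
have {}H : \sum_j normc (U i j) ^+ 2 = 1.
  rewrite -[RHS]H; apply: eq_bigr => l _; rewrite !mxE.
  case: (U i l) => a b /=; rewrite sqr_sqrtr ?addr_ge0 ?sqr_ge0 //; ring.
rewrite -(@ler_pXn2r _ 2) ?nnegrE ?normc_ge0 // expr1n -H (bigD1 j) //= lerDl.
by apply: sumr_ge0 => ? _; exact: sqr_ge0.
Qed.

Variables (n k : nat) (le_kn : (k <= n)%N).

Lemma head_colsM m p (A : 'M[C]_(m, p)) (B : 'M[C]_(p, n)) :
  head_cols le_kn (A *m B) = A *m head_cols le_kn B.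
Proof. by rewrite /head_cols mulmx_colsub. Qed.

Lemma last_colsM m p (A : 'M[C]_(m, p)) (B : 'M[C]_(p, n)) :
  last_cols le_kn (A *m B) = A *m last_cols le_kn B.
Proof. by rewrite /last_cols mulmx_colsub. Qed.

Lemma colsub_diag m (g : 'I_m -> 'I_n) p (A : 'M[C]_(p, n)) (s : 'rV[C]_n) :
  colsub g (A *m diag_mx s) = colsub g A *m diag_mx (colsub g s).
Proof. by rewrite !mul_mx_diag; apply/matrixP => i j; rewrite !mxE. Qed.

Lemma mul_ct_split m p (A : 'M[C]_(m, n)) (B : 'M[C]_(p, n)) :
  A *m B^t* = head_cols le_kn A *m (head_cols le_kn B)^t*
              + last_cols le_kn A *m (last_cols le_kn B)^t*.
Proof.
apply/matrixP => i j; rewrite !mxE.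
rewrite (reindex (cast_ord (subnK le_kn))) /=; last first.
  apply: onW_bij; exists (cast_ord (esym (subnK le_kn))).
    exact: cast_ordK.
  exact: cast_ordKV.
rewrite big_split_ord /=; by congr (_ + _); apply: eq_bigr => l _; rewrite !mxE.
Qed.

Lemma ct_last_cols (V : 'M[C]_n) : V \is unitarymx ->
  (last_cols le_kn V)^t* *m last_cols le_kn V = 1%:M.
Proof.
move=> /unitary_ctmul VV; pose g j := cast_ord (subnK le_kn) (@rshift (n - k) k j).
have -> : (last_cols le_kn V)^t* *m last_cols le_kn V = mxsub g g (V^t* *m V).
  by apply/matrixP => i j; rewrite !mxE; apply: eq_bigr => l _; rewrite !mxE.
rewrite VV; apply/matrixP => i j; rewrite !mxE (inj_eq (@cast_ord_inj _ _ _)).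
by rewrite (inj_eq (@rshift_inj _ _)).
Qed.

Lemma last_cols_proj (V : 'M[C]_n) v : V \is unitarymx ->
  im (last_cols le_kn V) v ->
  last_cols le_kn V *m ((last_cols le_kn V)^t* *m v) = v.
Proof.
move=> Vu [mu _ <-].
by rewrite (mulmxA (_ ^t*)) ct_last_cols // mul1mx.
Qed.

Lemma head_cols_proj (V : 'M[C]_n) : V \is unitarymx ->
  head_cols le_kn V *m (head_cols le_kn V)^t*
  = 1%:M - last_cols le_kn V *m (last_cols le_kn V)^t*.
Proof. by move/unitarymxP; rewrite mul_ct_split => <-; rewrite addrK. Qed.

Lemma nrm_colsub m (g : 'I_m -> 'I_n) p (A : 'M[C]_(p, n)) :
  nrm (colsub g A) <= nrm A *+ m *+ p.
Proof. by apply: nrm_le_entries => i j; rewrite mxE normc_le_nrm. Qed.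

Section SVD.
Variables (A U V : 'M[C]_n) (s : 'rV[R]_n).
Hypothesis svd : is_svd A U V s.

Lemma svd_mulmx : A *m V = U *m diag_mx (sigma_row s).
Proof. by case: svd => _ /unitary_ctmul VV _ _ ->; rewrite -mulmxA VV mulmx1. Qed.

Lemma svd_ctU : A^t* *m U = V *m diag_mx (sigma_row s).
Proof.
case: svd => /unitary_ctmul UU _ _ _ ->.
by rewrite !mulmx_ct trmxCK ct_real_diag -!mulmxA UU mulmx1.
Qed.

Lemma svd_last : A *m last_cols le_kn V =
  last_cols le_kn U *m diag_mx (last_cols le_kn (sigma_row s)).
Proof. by rewrite -last_colsM svd_mulmx /last_cols colsub_diag. Qed.

Lemma svd_head : A *m head_cols le_kn V =
  head_cols le_kn U *m diag_mx (head_cols le_kn (sigma_row s)).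
Proof. by rewrite -head_colsM svd_mulmx /head_cols colsub_diag. Qed.

Lemma ct_real_diag_colsub m (g : 'I_m -> 'I_n) :
  (diag_mx (colsub g (sigma_row s)))^t* = diag_mx (colsub g (sigma_row s)).
Proof.
have -> : colsub g (sigma_row s) = sigma_row (colsub g s).
  by apply/matrixP => i j; rewrite !mxE.
exact: ct_real_diag.
Qed.

Lemma svd_ct_last : (last_cols le_kn U)^t* *m A =
  diag_mx (last_cols le_kn (sigma_row s)) *m (last_cols le_kn V)^t*.
Proof.
rewrite -{1}[A]trmxCK -mulmx_ct -last_colsM svd_ctU /last_cols colsub_diag mulmx_ct.
by rewrite ct_real_diag_colsub.
Qed.

Lemma svd_ct_head : (head_cols le_kn U)^t* *m A =
  diag_mx (head_cols le_kn (sigma_row s)) *m (head_cols le_kn V)^t*.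
Proof.
rewrite -{1}[A]trmxCK -mulmx_ct -head_colsM svd_ctU /head_cols colsub_diag mulmx_ct.
by rewrite ct_real_diag_colsub.
Qed.

Let beta : R := 1 *+ n *+ n.

Lemma nrm_diag (y : 'cV[C]_n) :
  nrm (diag_mx (sigma_row s) *m y) = \sum_i s 0 i * normc (y i 0).
Proof.
case: svd => _ _ _ s0 _; rewrite /nrm mul_diag_mx; apply: eq_bigr => i _.
by rewrite big_ord1 !mxE Normc.normcM normc_real ger0_norm.
Qed.

Lemma nrm_col (y : 'cV[C]_n) : nrm y = \sum_i normc (y i 0).
Proof. by apply: eq_bigr => i _; rewrite big_ord1. Qed.

(** Some nonzero y supported on the indices j <= i satisfies A0 V y = 0, so that
|Sigma y|, which is at least s_i |y|, is of the order of |(A - A0) V y|. *)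
Lemma svd_small (A0 : 'M[C]_n) (i : 'I_n) : (\rank A0 <= i)%N ->
  s 0 i <= beta * nrm (A - A0) * beta.
Proof.
move=> ri; case: (svd) => Uu Vu sd s0 _; pose S := [set j : 'I_n | (j <= i)%N]%SET.
have cS : #|S| = i.+1.
  rewrite -[RHS]card_ord -(card_imset _ (@widen_ord_inj _ _ (ltn_ord i))).
  apply: eq_card => j; rewrite inE; apply/idP/imsetP => [ji|[l _ ->]].
    by exists (Ordinal (ji : (j < i.+1)%N)) => //; apply: val_inj.
  by rewrite /= -ltnS.
have [|y y0 [Ky yS]] := @supported_kernel _ _ _ (A0 *m V) S.
  by rewrite cS ltnS (leq_trans (mxrankM_maxl _ _)).
have yp : 0 < nrm y.
  by rewrite lt_neqAle nrm_ge0 andbT; apply: contra y0 => /eqP e;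
    rewrite (@nrm_eq0 _ _ _ y) // -e.
rewrite -(ler_pM2r yp).
have -> : s 0 i * nrm y = \sum_j s 0 i * normc (y j 0).
  by rewrite nrm_col mulr_sumr.
apply: (@le_trans _ _ (nrm (diag_mx (sigma_row s) *m y))).
  rewrite nrm_diag; apply: ler_sum => j _.
  have [|/yS ->] := boolP (j \in S); last by rewrite Normc.normc0 !mulr0.
  by rewrite inE => /sd ?; rewrite ler_wpM2r ?normc_ge0.
have -> : diag_mx (sigma_row s) *m y = U^t* *m ((A - A0) *m (V *m y)).
  rewrite mulmxBl [A0 *m _]mulmxA Ky subr0 [A *m _]mulmxA svd_mulmx -!mulmxA.
  by rewrite (mulmxA (U^t*)) (unitary_ctmul Uu) mul1mx.
rewrite -!mulrA (le_trans (nrmM _ _)) // nrm_ct ler_pM ?nrm_ge0 ?nrm_unitary //.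
rewrite (le_trans (nrmM _ _)) // ler_wpM2l ?nrm_ge0 // (le_trans (nrmM _ _)) //.
by rewrite ler_wpM2r ?nrm_ge0 ?nrm_unitary.
Qed.

(** Some nonzero y supported on the indices j >= i satisfies V y = G A0 V y, so
that |A0 V y| cannot be small, whereas |A V y| is of the order of s_i |y| at
most. *)
Lemma svd_large (A0 G : 'M[C]_n) (i : 'I_n) :
  (\rank (1%:M - G *m A0)%R < n - i)%N ->
  1 <= beta * nrm G * beta * (s 0 i + nrm (A - A0)).
Proof.
move=> ri; case: (svd) => Uu Vu sd s0 _; pose S := [set j : 'I_n | (i <= j)%N]%SET.
have cS : #|S| = (n - i)%N.
  suff Ci : #|(~: S)%SET| = i.
    have := cardsC S; rewrite card_ord Ci => /(congr1 (subn^~ i)).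
    by rewrite addnK.
  rewrite -[RHS]card_ord -(card_imset _ (@widen_ord_inj _ _ (ltnW (ltn_ord i)))).
  apply: eq_card => j; rewrite !inE -ltnNge; apply/idP/imsetP => [ji|[l _ ->]].
    by exists (Ordinal ji) => //; apply: val_inj.
  by rewrite /= ltn_ord.
have [|y y0 [Ky yS]] := @supported_kernel _ _ _ ((1%:M - G *m A0) *m V) S.
  by rewrite cS (leq_ltn_trans (mxrankM_maxl _ _)).
have yp : 0 < nrm y.
  by rewrite lt_neqAle nrm_ge0 andbT; apply: contra y0 => /eqP e;
    rewrite (@nrm_eq0 _ _ _ y) // -e.
rewrite -(ler_pM2r yp) mul1r.
have {1}-> : y = V^t* *m (G *m (A0 *m (V *m y))).
  move/eqP: Ky; rewrite mulmxBl mul1mx mulmxBl subr_eq0 => /eqP Ky.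
  have -> : G *m (A0 *m (V *m y)) = V *m y by rewrite !mulmxA -Ky.
  by rewrite mulmxA (unitary_ctmul Vu) mul1mx.
rewrite -!mulrA (le_trans (nrmM _ _)) // nrm_ct ler_pM ?nrm_ge0 ?nrm_unitary //.
rewrite (le_trans (nrmM _ _)) // ler_wpM2l ?nrm_ge0 //.
have -> : A0 *m (V *m y) = U *m (diag_mx (sigma_row s) *m y) - (A - A0) *m (V *m y).
  rewrite [U *m (_ *m y)]mulmxA -svd_mulmx -[A *m V *m y]mulmxA mulmxBl opprB.
  by rewrite addrC subrK.
rewrite (le_trans (nrmB _ _)) // mulrDl mulrDr lerD //.
  rewrite (le_trans (nrmM _ _)) // ler_pM ?nrm_ge0 ?nrm_unitary //.
  rewrite nrm_diag nrm_col mulr_sumr; apply: ler_sum => j _.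
  have [|/yS ->] := boolP (j \in S); last by rewrite Normc.normc0 !mulr0.
  by rewrite inE => /sd ?; rewrite ler_wpM2r ?normc_ge0.
rewrite (le_trans (nrmM _ _)) // mulrCA ler_wpM2l ?nrm_ge0 //.
by rewrite (le_trans (nrmM _ _)) // ler_wpM2r ?nrm_ge0 ?nrm_unitary.
Qed.

End SVD.
End Columns.

(** * The Hessian and the deflation-one condition *)
Section Hessian.
Variables (R : realType) (n : nat) (f : polysys R n) (x : 'cV[R[i]]_n).
Local Notation C := R[i].

Lemma hessian_dirE u :
  hessian_dir f x u = \sum_l u l 0 *: hessian_dir f x (delta_mx l 0).
Proof.
apply/matrixP => i j; rewrite summxE mxE; apply: eq_bigr => l _.
rewrite !mxE (bigD1 l) //= big1 ?addr0 => [|l' l'l]; last first.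
  by rewrite mxE (negPf l'l) mulr0.
by rewrite mxE !eqxx mulr1 mulrC.
Qed.

Lemma hessian_dirD u w :
  hessian_dir f x (u + w) = hessian_dir f x u + hessian_dir f x w.
Proof.
apply/matrixP => i j; rewrite !mxE -big_split; apply: eq_bigr => l _.
by rewrite mxE mulrDr.
Qed.

Lemma hessian_dirZ a u : hessian_dir f x (a *: u) = a *: hessian_dir f x u.
Proof.
apply/matrixP => i j; rewrite !mxE mulr_sumr; apply: eq_bigr => l _.
by rewrite mxE mulrCA.
Qed.

Lemma nrm_hessian_dir u :
  nrm (hessian_dir f x u) <=
  nrm u * \sum_l nrm (hessian_dir f x (delta_mx l 0)).
Proof.
rewrite hessian_dirE (le_trans (nrm_sum _ _)) // mulr_sumr.
by apply: ler_sum => l _; rewrite nrmZ ler_wpM2r ?nrm_ge0 // normc_le_nrm.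
Qed.

Lemma algebraic_singular m k (D : 'M[C]_(m, n)) (A : 'M[C]_(k, n))
    (B : 'M[C]_(n, k)) :
  algebraic_set [set w | D *m w = 0 /\ \det (A *m hessian_dir f x w *m B) = 0].
Proof.
have := algebraic_ker_det D (fun l => A *m hessian_dir f x (delta_mx l 0) *m B).
congr (algebraic_set _); apply/seteqP; split=> w /=;
  rewrite hessian_dirE mulmx_sumr mulmx_suml;
  by under eq_bigr do rewrite scalemxAl scalemxAr.
Qed.

End Hessian.

(** A direction u = W2 lambda for which the deflated Jacobian matrix has full
column rank will do.  If z is in the kernel of L (D^2 f(xi) u) N, then
D^2 f(xi) u maps N z into the image of A, which is the image of A W1, because
A W2 = 0.  This yields a vector in the kernel of the deflated Jacobian matrix
with first component N z, whence N z = 0 and z = 0. *)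
Lemma nondegenerate_direction (R : realType) n (f : polysys R n)
    (xi : 'cV[R[i]]_n)
    (k := ker_dim (jacobian f xi)) (G : 'M[R[i]]_n) (N P : 'M[R[i]]_(n, k))
    (M L : 'M[R[i]]_(k, n)) :
  deflation_one_singular_zero f xi ->
  jacobian f xi *m N = 0 -> M *m N = 1%:M ->
  1%:M - jacobian f xi *m G = P *m L ->
  exists2 u : 'cV[R[i]]_n, jacobian f xi *m u = 0 &
    L *m hessian_dir f xi u *m N \in unitmx.
Proof.
set A := jacobian f xi.
move=> [_ [W1 [W2 [/andP[Wfree _] _ imW2 [Z [_ ZP aa]]]]]] AN MN AGE.
have [la nZla] : exists la, ~ Z la.
  apply: contrapT => nZ; case: ZP => _; apply => la _.
  by apply: contrapT => ?; apply: nZ; exists la.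
have /eqP full := aa la I nZla.
have AW2 (mu : 'cV_k) : A *m (W2 *m mu) = 0.
  have : im W2 (W2 *m mu) by exists mu.
  by rewrite imW2.
exists (W2 *m la) => //; apply: unitmx_inj => z Mz.
have [B WB] := row_freeP Wfree.
pose b := hessian_dir f xi (W2 *m la) *m (N *m z).
have Lb : L *m b = 0 by rewrite -[RHS]Mz /b !mulmxA.
have bE : b = A *m (G *m b).
  apply/eqP; rewrite -subr_eq0 mulmxA -{1}[b]mul1mx -mulmxBl AGE -mulmxA.
  by rewrite Lb mulmx0.
pose y := usubmx B *m (G *m b).
have bW1 : b = A *m (W1 *m y).
  rewrite {1}bE -[G *m b]mul1mx -WB -{1}[B]vsubmxK mul_row_col mulmxDl mulmxDr.
  by rewrite -!mulmxA AW2 addr0.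
have full' : row_full (block_mx A 0 (hessian_dir f xi (W2 *m la)) (A *m W1)).
  exact: full.
have : col_mx (N *m z) (- y) = 0.
  apply: (row_full_inj full'); rewrite mulmx0 mul_block_col mulmxA AN mul0mx.
  by rewrite mul0mx addr0 -/b bW1 mulmxN mulmxA subrr col_mx0.
rewrite -[RHS]col_mx0 => /eq_col_mx[Nz _].
by rewrite -[z]mul1mx -MN -mulmxA Nz mulmx0.
Qed.

(** * Estimates near the singular zero *)
Section Local.
Variables (R : realType) (n : nat) (f : polysys R n) (xi : 'cV[R[i]]_n).
Variables (k : nat) (le_kn : (k <= n)%N).
Local Notation C := R[i].
Local Notation A0 := (jacobian f xi).
Variables (G : 'M[C]_n) (N : 'M[C]_(n, k)) (M L : 'M[C]_(k, n)).
Hypothesis fxi : evalsys f xi = 0.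
Hypothesis rA0 : \rank A0 = (n - k)%N.
Hypothesis A0N : A0 *m N = 0.
Hypothesis LA0 : L *m A0 = 0.
Hypothesis GE : 1%:M - G *m A0 = N *m M.

(** The index type of the estimates: a point with a singular value decomposition
of the Jacobian matrix there. *)
Record svd_point := SvdPoint {
  pt_x : 'cV[C]_n; pt_U : 'M[C]_n; pt_V : 'M[C]_n; pt_s : 'rV[R]_n;
  pt_svd : is_svd (jacobian f pt_x) pt_U pt_V pt_s }.

Definition dist_xi (p : svd_point) : R := nrm (pt_x p - xi).

Lemma dist_xi_ge0 p : 0 <= dist_xi p.
Proof. exact: nrm_ge0. Qed.

Local Notation O := (isO dist_xi).
Local Notation A p := (jacobian f (pt_x p)).
Local Notation U1 p := (head_cols le_kn (pt_U p)).
Local Notation U2 p := (last_cols le_kn (pt_U p)).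
Local Notation V1 p := (head_cols le_kn (pt_V p)).
Local Notation V2 p := (last_cols le_kn (pt_V p)).
Local Notation Sigma1 p := (diag_mx (head_cols le_kn (sigma_row (pt_s p)))).
Local Notation Sigma2 p := (diag_mx (last_cols le_kn (sigma_row (pt_s p)))).
Local Notation x' p := (first_step f le_kn (pt_x p) (pt_U p) (pt_V p) (pt_s p)).
Local Notation err p := (pt_x p - xi).

Lemma isO_unitary_cols m (g : 'I_m -> 'I_n) (W : svd_point -> 'M[C]_n) :
  (forall p, W p \is unitarymx) -> O (fun p => colsub g (W p)) 0.
Proof.
move=> Wu; apply: isO_bounded => p; apply: le_trans (nrm_colsub _ _) _.
by do 2![apply: ler_wMn2r]; exact: nrm_unitary.
Qed.

Lemma pt_U_unitary p : pt_U p \is unitarymx. Proof. by case: (pt_svd p). Qed.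
Lemma pt_V_unitary p : pt_V p \is unitarymx. Proof. by case: (pt_svd p). Qed.

Lemma isO_U1 : O (fun p => U1 p) 0.
Proof. exact: (isO_unitary_cols _ pt_U_unitary). Qed.
Lemma isO_U2 : O (fun p => U2 p) 0.
Proof. exact: (isO_unitary_cols _ pt_U_unitary). Qed.
Lemma isO_V1 : O (fun p => V1 p) 0.
Proof. exact: (isO_unitary_cols _ pt_V_unitary). Qed.
Lemma isO_V2 : O (fun p => V2 p) 0.
Proof. exact: (isO_unitary_cols _ pt_V_unitary). Qed.

Lemma isO_err : O (fun p => err p) 1.
Proof. by exists 1, 1; split=> // p _; rewrite mul1r expr1. Qed.

Lemma isO_jacobian_err : O (fun p => A p - A0) 1.
Proof. exact: (isO_jacobian dist_xi_ge0 isO_err). Qed.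

Lemma isO_Sigma2 : O (fun p => Sigma2 p) 1.
Proof.
pose b : R := 1 *+ n *+ n; have b0 : 0 <= b by rewrite !mulrn_wge0.
apply: (@isO_le _ _ _ _ _ _ _ _ _ _ ((b * b) *+ k *+ k) _ _ isO_jacobian_err).
  by rewrite !mulrn_wge0 ?mulr_ge0.
move=> p; set c := nrm (A p - A0).
have -> : b * b *+ k *+ k * c = (b * b * c) *+ k *+ k by rewrite !mulrnAl.
apply: nrm_le_entries => i j; rewrite !mxE.
have [_|_] := eqVneq i j; last by rewrite mulr0n Normc.normc0 !mulr_ge0 ?nrm_ge0.
rewrite mulr1n normc_real; case: (pt_svd p) => _ _ _ s0 _.
rewrite ger0_norm // mulrAC; apply: (svd_small (pt_svd p)).
by rewrite rA0 /= leq_addr.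
Qed.

Lemma isO_A0V2 : O (fun p => A0 *m V2 p) 1.
Proof.
have H1 := isOM isO_U2 isO_Sigma2; have H2 := isOM isO_jacobian_err isO_V2.
rewrite add0n in H1; rewrite addn0 in H2.
apply: isO_eq (isOB H1 H2) => p.
by rewrite -(svd_last _ (pt_svd p)) mulmxBl opprB addrC subrK.
Qed.

Lemma isO_U2A0 : O (fun p => (U2 p)^t* *m A0) 1.
Proof.
have H1 := isOM isO_Sigma2 (isO_ct isO_V2).
have H2 := isOM (isO_ct isO_U2) isO_jacobian_err.
rewrite add0n in H2; rewrite addn0 in H1.
apply: isO_eq (isOB H1 H2) => p.
by rewrite -(svd_ct_last _ (pt_svd p)) mulmxBr opprB addrC subrK.
Qed.

Lemma A0GA0 : A0 *m G *m A0 = A0.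
Proof.
have := congr1 (mulmx A0) GE; rewrite mulmxBr mulmx1 mulmxA A0N mul0mx mulmxA.
by move/eqP; rewrite subr_eq0 => /eqP.
Qed.

(** Inserting a generalized inverse between two factors that are both small shows
that this block is of second order, although A0 - Df(x) is only of first
order. *)
Lemma isO_U2A0V2 : O (fun p => (U2 p)^t* *m A0 *m V2 p) 2.
Proof.
have := isOM (isOM isO_U2A0 (isO_cst dist_xi G)) isO_A0V2; rewrite addn0.
by apply: isO_eq => p; rewrite -{3}A0GA0 !mulmxA.
Qed.

(** [svd_large] applies to the first n - k indices, as the projection
1 - G A0 = N M has rank at most k. *)
Lemma Sigma1_unit : exists d c : R, 0 < d /\ forall p, dist_xi p < d ->
  Sigma1 p \in unitmx /\ nrm (invmx (Sigma1 p)) <= c.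
Proof.
pose b : R := 1 *+ n *+ n; pose g := b * nrm G * b.
have g0 : 0 <= g by rewrite !mulr_ge0 ?nrm_ge0 ?mulrn_wge0.
have a0 : 0 < (2 * (g + 1))^-1 by rewrite invr_gt0; lra.
have [d d0 Hd] := isO_lt dist_xi_ge0 a0 isO_jacobian_err.
exists d, ((2 * (g + 1))^-1^-1 *+ (n - k) *+ (n - k)); split=> // p /Hd Hp.
apply: nrm_invmx_diag => // i; rewrite !mxE normc_real; set j := cast_ord _ _.
case: (pt_svd p) => _ _ _ s0 _; rewrite ger0_norm //.
have jk : (\rank (1%:M - G *m A0)%R < n - j)%N.
  rewrite GE (leq_ltn_trans (mxrankM_maxl _ _)) //.
  rewrite (leq_ltn_trans (rank_leq_col _)) // ltn_subRL addnC -ltn_subRL.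
  by rewrite [X in (X < _)%N]/= ltn_ord.
have := svd_large (pt_svd p) jk; rewrite -/b -/g.
set t := nrm _ in Hp *; set sj := pt_s p 0 j => H.
have u0 : 0 < 2 * (g + 1) by lra.
rewrite leNgt; apply/negP => sl.
have tl : t * (2 * (g + 1)) < 1 by rewrite -ltr_pdivlMr ?div1r.
have {}sl : sj * (2 * (g + 1)) < 1 by rewrite -ltr_pdivlMr ?div1r.
have := nrm_ge0 (A p - A0); have := s0 j; rewrite -/t -/sj; lra.
Qed.

Lemma isO_invSigma1 : O (fun p => invmx (Sigma1 p)) 0.
Proof.
have [d [c [d0 H]]] := Sigma1_unit; exists `|c|, d; split=> // p /H[_ Hc].
by rewrite expr0 mulr1 (le_trans Hc) // ler_norm.
Qed.

Lemma isO_LU1 : O (fun p => L *m U1 p) 1.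
Proof.
have [d [c [d0 H]]] := Sigma1_unit.
have := isOM (isOM (isOM (isO_cst dist_xi L) isO_jacobian_err) isO_V1) isO_invSigma1.
rewrite add0n !addn0; apply: isO_near d0 _ => p /H[Su _].
rewrite mulmxBr LA0 subr0 -[L *m _ *m _]mulmxA (svd_head _ (pt_svd p)) mulmxA.
by rewrite mulmxK.
Qed.

(** The step V1 Sigma1^-1 U1^H f(x) agrees with V1 V1^H (x - xi) to second order,
so only the component along V2 remains. *)
Lemma isO_first_step : O (fun p => x' p - xi - V2 p *m ((V2 p)^t* *m err p)) 2.
Proof.
have [d [c [d0 H]]] := Sigma1_unit.
have Of := isO_evalsys dist_xi_ge0 isO_err fxi.
have := isON (isOM (isOM (isOM isO_V1 isO_invSigma1) (isO_ct isO_U1)) Of).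
rewrite !add0n; apply: isO_near d0 _ => p /H[Su _].
rewrite mulmxBr opprB /first_step; set Q := V1 p *m _ *m _.
have -> : Q *m (A p *m err p) = err p - V2 p *m ((V2 p)^t* *m err p).
  rewrite mulmxA -[Q *m _]mulmxA (svd_ct_head _ (pt_svd p)).
  rewrite -[V1 p *m _ *m _]mulmxA mulKmx // [V2 p *m _]mulmxA.
  by rewrite (head_cols_proj _ (pt_V_unitary p)) mulmxBl mul1mx.
by rewrite addrAC [in RHS](addrAC _ _ (- xi)).
Qed.

Lemma isO_first_step_err : O (fun p => x' p - xi) 1.
Proof.
have := isOD (isO_weaken dist_xi_ge0 (leqnSn 1) isO_first_step)
  (isOM isO_V2 (isOM (isO_ct isO_V2) isO_err)).
by apply: isO_eq => p; rewrite subrK.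
Qed.

Local Notation H w := (hessian_dir f xi w).
Local Notation Mw w := (L *m H w *m N).

(** A sample vector v together with a nearby vector w at which the limit matrix
M_w is invertible; b bounds everything that has to be bounded uniformly.  The
vector w is kept abstract because it is chosen in two ways: as the projection of
v to the kernel for a given v, and as a fixed nondegenerate direction when v is
constructed from it. *)
Record sample (b : R) := Sample {
  sm_pt : svd_point; sm_v : 'cV[C]_n; sm_w : 'cV[C]_n;
  sm_im : im (last_cols le_kn (pt_V sm_pt)) sm_v;
  sm_nrm : nrm sm_v <= b;
  sm_near : nrm (sm_v - sm_w) <= b * dist_xi sm_pt;
  sm_unit : Mw sm_w \in unitmx;
  sm_inv : nrm (invmx (Mw sm_w)) <= b }.

Section Sampled.
Variable b : R.

Definition sm_dist (q : sample b) : R := dist_xi (sm_pt q).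

Lemma sm_dist_ge0 q : 0 <= sm_dist q. Proof. exact: nrm_ge0. Qed.

Local Notation OS := (isO sm_dist).
Local Notation pt := sm_pt.

Lemma isO_sample m l (F : svd_point -> 'M[C]_(m, l)) p :
  O F p -> OS (fun q => F (pt q)) p.
Proof. by move=> [c [d [c0 d0 Hd]]]; exists c, d; split=> // q /Hd. Qed.

Lemma isO_v : OS (@sm_v b) 0.
Proof. by apply: isO_bounded => q; exact: sm_nrm. Qed.

Lemma isO_vw : OS (fun q => sm_v q - sm_w q) 1.
Proof.
exists `|b|, 1; split=> // q _; rewrite expr1 (le_trans (sm_near q)) //.
by rewrite ler_wpM2r ?sm_dist_ge0 // ler_norm.
Qed.

Lemma isO_w : OS (@sm_w b) 0.
Proof.
have := isOB isO_v (isO_weaken sm_dist_ge0 (leq0n 1) isO_vw).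
by apply: isO_eq => q; rewrite opprB addrC subrK.
Qed.

Local Notation Hx q := (hessian_dir f (x' (pt q)) (sm_v q)).
Local Notation Bq q := (second_step_mx f le_kn (x' (pt q)) (pt_U (pt q))
   (pt_V (pt q)) (sm_v q)).
Local Notation Iq q := (invmx (Mw (sm_w q))).

Lemma isO_Hx : OS (fun q => Hx q - H (sm_w q)) 1.
Proof.
exact: (isO_hessian sm_dist_ge0 (isO_sample isO_first_step_err) _ isO_v isO_vw).
Qed.

Lemma isO_H : OS (fun q => H (sm_w q)) 0.
Proof.
apply: isO_le isO_w => [|q]; last by rewrite mulrC; exact: nrm_hessian_dir.
by apply: sumr_ge0 => l _; exact: nrm_ge0.
Qed.

Lemma isO_Hx_bounded : OS (fun q => Hx q) 0.
Proof.
have := isOD (isO_weaken sm_dist_ge0 (leq0n 1) isO_Hx) isO_H.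
by apply: isO_eq => q; rewrite subrK.
Qed.

Lemma isO_invMw : OS (fun q => Iq q) 0.
Proof. by apply: isO_bounded => q; exact: sm_inv. Qed.

(** For x = xi and w = v this is the inverse of B'. *)
Definition approx_inv (q : sample b) : 'M[C]_k :=
  (V2 (pt q))^t* *m N *m Iq q *m (L *m U2 (pt q)).

Local Notation K q :=
  ((L *m (Hx q - H (sm_w q)) *m N) *m (M *m V2 (pt q))
   + L *m Hx q *m G *m (A0 *m V2 (pt q))
   - (L *m U1 (pt q)) *m ((U1 (pt q))^t* *m Hx q *m V2 (pt q))).

Definition defect (q : sample b) : 'M[C]_k :=
  (V2 (pt q))^t* *m N *m Iq q *m K q
  - (V2 (pt q))^t* *m G *m (A0 *m V2 (pt q)).

Lemma V2_split p : V2 p = N *m (M *m V2 p) + G *m (A0 *m V2 p).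
Proof. by rewrite !mulmxA -mulmxDl -GE subrK mul1mx. Qed.

(** L U2 U2^H = L - L U1 U1^H turns L U2 B' into L (D^2 f(x') v) V2 up to a small
term; then V2 = N M V2 + G A0 V2 and D^2 f(x') v, which is close to D^2 f(xi) w,
bring in M_w, which cancels its inverse. *)
Lemma approx_invE q : approx_inv q *m Bq q = 1%:M + defect q.
Proof.
have LB : (L *m U2 (pt q)) *m Bq q =
    Mw (sm_w q) *m (M *m V2 (pt q)) + K q.
  have -> : (L *m U2 (pt q)) *m Bq q =
      L *m Hx q *m V2 (pt q)
      - (L *m U1 (pt q)) *m ((U1 (pt q))^t* *m Hx q *m V2 (pt q)).
    rewrite /second_step_mx !mulmxA -mulmxBl -mulmxBl; congr (_ *m _ *m _).
    rewrite -!mulmxA (head_cols_proj _ (pt_U_unitary _)) mulmxBr mulmx1.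
    by rewrite opprB addrC subrK.
  rewrite addrA; congr (_ - _).
  rewrite {1}V2_split mulmxDr addrA; congr (_ + _); last by rewrite mulmxA.
  rewrite -mulmxDl mulmxA; congr (_ *m _).
  by rewrite -mulmxDl -mulmxDr addrC subrK.
rewrite /approx_inv -[LHS]mulmxA LB mulmxDr /defect [RHS]addrA [RHS]addrAC.
congr (_ + _).
rewrite -[_ *m Iq q *m _]mulmxA mulKmx ?sm_unit //.
have NMV : N *m (M *m V2 (pt q)) = V2 (pt q) - G *m (A0 *m V2 (pt q)).
  by apply/esym/eqP; rewrite subr_eq; apply/eqP/V2_split.
rewrite -[LHS]mulmxA NMV mulmxBr; congr (_ - _); last exact: mulmxA.
exact: ct_last_cols (pt_V_unitary _).
Qed.

Lemma isO_approx_inv : OS approx_inv 0.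
Proof.
exact: (isOM (isOM (isOM (isO_ct (isO_sample isO_V2)) (isO_cst _ N)) isO_invMw)
  (isOM (isO_cst _ L) (isO_sample isO_U2))).
Qed.

Lemma isO_defect : OS defect 1.
Proof.
apply: isOB.
  apply: (@isOM _ _ _ _ _ _ _ _ 0 1).
    exact: (isOM (isOM (isO_ct (isO_sample isO_V2)) (isO_cst _ N)) isO_invMw).
  apply: isOB; first apply: isOD.
  - exact: (isOM (isOM (isOM (isO_cst _ L) isO_Hx) (isO_cst _ N))
      (isOM (isO_cst _ M) (isO_sample isO_V2))).
  - exact: (isOM (isOM (isOM (isO_cst _ L) isO_Hx_bounded) (isO_cst _ G))
      (isO_sample isO_A0V2)).
  exact: (isOM (isO_sample isO_LU1)
    (isOM (isOM (isO_ct (isO_sample isO_U1)) isO_Hx_bounded) (isO_sample isO_V2))).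
exact: (isOM (isOM (isO_ct (isO_sample isO_V2)) (isO_cst _ G))
  (isO_sample isO_A0V2)).
Qed.

Lemma sample_unit : exists2 d : R, 0 < d &
  forall q : sample b, sm_dist q < d -> Bq q \in unitmx.
Proof.
have h0 : (0 : R) < 2^-1 by rewrite invr_gt0.
have [d d0 Hd] := isO_lt sm_dist_ge0 h0 isO_defect.
exists d => // q /Hd/ltW Eq; apply: unitmx_inj => z Bz.
apply: nrm_eq0; apply: le_trans (nrm_absorb z Eq) _.
have -> : z + defect q *m z = approx_inv q *m (Bq q *m z).
  by rewrite mulmxA approx_invE mulmxDl mul1mx.
by rewrite Bz mulmx0 nrm0 mulr0.
Qed.

Record newton_step := NewtonStep {
  nw_sm : sample b; nw_delta : 'cV[C]_k;
  nw_eq : Bq nw_sm *m nw_delta =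
    - ((U2 (pt nw_sm))^t* *m jacobian f (x' (pt nw_sm)) *m sm_v nw_sm) }.

Definition nw_dist (t : newton_step) : R := sm_dist (nw_sm t).

Lemma nw_dist_ge0 t : 0 <= nw_dist t. Proof. exact: nrm_ge0. Qed.

Lemma isO_newton m l (F : sample b -> 'M[C]_(m, l)) p :
  OS F p -> isO nw_dist (fun t => F (nw_sm t)) p.
Proof. by move=> [c [d [c0 d0 Hd]]]; exists c, d; split=> // t /Hd. Qed.

Local Notation npt t := (pt (nw_sm t)).
Local Notation a t := ((V2 (npt t))^t* *m err (npt t)).

(** B' delta is known from the linear system and B' a from the expansion of
Df(x') v at xi; the terms of first order cancel. *)
Lemma isO_B_delta_a :
  isO nw_dist (fun t => Bq (nw_sm t) *m (nw_delta t + a t)) 2.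
Proof.
pose D1 (q : sample b) := jacobian f (x' (pt q)) *m sm_v q - A0 *m sm_v q
             - Hx q *m (x' (pt q) - xi).
pose D2 (q : sample b) :=
  (U2 (pt q))^t* *m A0 *m V2 (pt q) *m ((V2 (pt q))^t* *m sm_v q).
pose D3 (q : sample b) :=
  x' (pt q) - xi - V2 (pt q) *m ((V2 (pt q))^t* *m err (pt q)).
pose F (q : sample b) :=
  - ((U2 (pt q))^t* *m D1 q) - D2 q - (U2 (pt q))^t* *m (Hx q *m D3 q).
have OD1 : OS D1 2.
  exact: (isO_jacobian_taylor sm_dist_ge0 (isO_sample isO_first_step_err) f isO_v).
have OD2 : OS D2 2.
  exact: (isOM (isO_sample isO_U2A0V2) (isOM (isO_ct (isO_sample isO_V2)) isO_v)).
have OD3 : OS D3 2 := isO_sample isO_first_step.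
have OU2 := isO_ct (isO_sample isO_U2).
have OF : OS F 2.
  exact: (isOB (isOB (isON (isOM OU2 OD1)) OD2) (isOM OU2 (isOM isO_Hx_bounded OD3))).
apply: isO_eq (isO_newton OF) => t; rewrite mulmxDr nw_eq /F.
set q := nw_sm t; have -> : D2 q = (U2 (pt q))^t* *m (A0 *m sm_v q).
  rewrite /D2 -[in RHS](last_cols_proj (pt_V_unitary (pt q)) (sm_im q)).
  by rewrite !mulmxA.
have -> : Bq q *m a t = (U2 (pt q))^t* *m (Hx q *m (V2 (pt q) *m a t)).
  by rewrite /second_step_mx !mulmxA.
have -> : Hx q *m (V2 (pt q) *m a t) = Hx q *m (x' (pt q) - xi) - Hx q *m D3 q.
  by rewrite -mulmxBr /D3 subKr.
rewrite -(mulmxA _ (jacobian f _)).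
have -> : jacobian f (x' (pt q)) *m sm_v q =
    D1 q + A0 *m sm_v q + Hx q *m (x' (pt q) - xi).
  by rewrite /D1 addrAC subrK subrK.
move: (D1 q) (A0 *m sm_v q) (Hx q *m (_ - xi)) (Hx q *m D3 q).
by move=> w1 w2 w3 w4; rewrite mulmxBr !mulmxDr opprD addrA subrK opprD.
Qed.

Lemma isO_newton_step : isO nw_dist
  (fun t => x' (npt t) + V2 (npt t) *m nw_delta t - xi) 2.
Proof.
have Oda : isO nw_dist (fun t => nw_delta t + a t) 2.
  apply: (isO_absorb nw_dist_ge0 (isO_newton isO_defect)).
  have := isOM (isO_newton isO_approx_inv) isO_B_delta_a; rewrite add0n.
  by apply: isO_eq => t; rewrite mulmxA approx_invE mulmxDl mul1mx.
have := isOD (isO_newton (isO_sample isO_first_step))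
  (isOM (isO_newton (isO_sample isO_V2)) Oda).
apply: isO_eq => t; move: (a t) => y; rewrite mulmxDr [V2 _ *m _ + _]addrC addrA subrK.
by rewrite addrAC.
Qed.

End Sampled.
Variable u : 'cV[C]_n.
Hypothesis A0u : A0 *m u = 0.
Hypothesis Mu : Mw u \in unitmx.

(** The exceptional set: the sample vectors are required to stay away from it. *)
Definition degenerate : set 'cV[C]_n :=
  [set w | A0 *m w = 0 /\ \det (Mw w) = 0].

Lemma degenerate_algebraic : algebraic_set degenerate.
Proof. exact: algebraic_singular. Qed.

Lemma degenerate_proper : degenerate `<` ker A0.
Proof.
split=> [w []//|H]; have [_] := H u A0u.
by move: Mu; rewrite unitmxE unitfE => /eqP.
Qed.

Lemma near_xi d : 0 < d -> exists2 r : R, 0 < r < 1 &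
  forall x : 'cV[C]_n, enorm (x - xi) < r -> nrm (x - xi) < d.
Proof.
move=> d0; have n0 : 0 < n%:R + 1 :> R by rewrite ltr_wpDl.
exists (Num.min 2^-1 (d / (n%:R + 1))).
  by rewrite lt_min gt_min invr_gt0 ltr0n divr_gt0 // invf_lt1 // ltr1n.
move=> x; rewrite lt_min ltr_pdivlMr // => /andP[_ xd].
apply: le_lt_trans (nrm_le_enorm _) (le_lt_trans _ xd).
by rewrite mulrC ler_wpM2l ?enorm_ge0 // lerDl.
Qed.

(** A fixed kernel vector of A0 is almost in the image of V2: its component along
V1 is V1 Sigma1^-1 U1^H (Df(x) - A0) u. *)
Lemma isO_proj_ker : O (fun p : svd_point => V2 p *m ((V2 p)^t* *m u) - u) 1.
Proof.
have [d [c [d0 H]]] := Sigma1_unit.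
have := isON (isOM (isOM (isOM isO_V1 isO_invSigma1) (isO_ct isO_U1))
  (isOM isO_jacobian_err (isO_cst dist_xi u))).
apply: isO_near d0 _ => p /H[Su _].
rewrite mulmxBl A0u subr0 mulmxA -[_ *m (_ ^t*) *m _]mulmxA.
rewrite (svd_ct_head _ (pt_svd p)) -[V1 p *m _ *m _]mulmxA mulKmx //.
rewrite (head_cols_proj _ (pt_V_unitary p)).
by rewrite mulmxBl mul1mx opprB mulmxA.
Qed.

(** The witness is v = V2 V2^H u, compared with w = u. *)
Lemma generic_sample_unit : exists2 d : R, 0 < d &
  forall p : svd_point, dist_xi p < d ->
    exists2 v, im (V2 p) v & second_step_mx f le_kn
      (first_step f le_kn (pt_x p) (pt_U p) (pt_V p) (pt_s p))
      (pt_U p) (pt_V p) v \in unitmx.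
Proof.
have [c [d1 [c0 d10 H1]]] := isO_proj_ker.
have OV := isO_V2.
have [c' [d2 [c0' d20 H2]]] := isOM (isOM OV (isO_ct OV)) (isO_cst dist_xi u).
pose b := c + c' + nrm (invmx (Mw u)).
have i0 := nrm_ge0 (invmx (Mw u)).
have [d3 d30 H3] := sample_unit b.
exists (Num.min d1 (Num.min d2 d3)); first by rewrite !lt_min d10 d20.
move=> p; rewrite !lt_min => /and3P[/H1 Hp1 /H2 Hp2 pd3].
have vim : im (V2 p) (V2 p *m ((V2 p)^t* *m u)) by exists ((V2 p)^t* *m u).
have vb : nrm (V2 p *m ((V2 p)^t* *m u)) <= b.
  by move: Hp2; rewrite expr0 -mulmxA /b; lra.
have vu : nrm (V2 p *m ((V2 p)^t* *m u) - u) <= b * dist_xi p.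
  rewrite (le_trans Hp1) // expr1 ler_wpM2r ?dist_xi_ge0 // /b; lra.
have ib : nrm (invmx (Mw u)) <= b by rewrite /b; lra.
by have := H3 (Sample vim vb vu Mu ib) pd3; exists (V2 p *m ((V2 p)^t* *m u)).
Qed.

(** Every zero t of det (M_w + t M_u) gives a point w + t u of the exceptional
set, hence satisfies |t| |u| >= rho.  The denominator is |u| + 1 to cover u = 0,
which occurs when k = 0. *)
Lemma degenerate_inv_bound (rho b : R) : 0 < rho -> exists b' : R,
  forall w, A0 *m w = 0 -> nrm w <= b ->
    (forall z, degenerate z -> rho <= nrm (w - z)) ->
    Mw w \in unitmx /\ nrm (invmx (Mw w)) <= b'.
Proof.
move=> rho0; pose h := \sum_l nrm (hessian_dir f xi (delta_mx l 0)).
pose r := rho / (nrm u + 1).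
have u0 : 0 < nrm u + 1 by rewrite ltr_wpDl ?nrm_ge0.
have dMu0 : 0 < normc (\det (Mw u)).
  rewrite lt_neqAle normc_ge0 andbT eq_sym; apply/eqP => /Normc.eq0_normc d0.
  by move: Mu; rewrite unitmxE unitfE d0 eqxx.
have c0 : 0 < normc (\det (Mw u)) * r ^+ k.
  by rewrite mulr_gt0 // exprn_gt0 // divr_gt0.
have h0 : 0 <= h by apply: sumr_ge0 => l _; exact: nrm_ge0.
have [b' Hb'] := nrm_invmx k (nrm L * (b * h) * nrm N) c0.
exists b' => w A0w wb wZ.
apply: Hb'.
  rewrite (le_trans (nrmM _ _)) // ler_wpM2r ?nrm_ge0 //.
  rewrite (le_trans (nrmM _ _)) // ler_wpM2l ?nrm_ge0 //.
  by rewrite (le_trans (nrm_hessian_dir _ _ _)) // ler_wpM2r.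
apply: det_pencil_lower => //; first by rewrite divr_ge0 ?ltW.
move=> z dz; rewrite /r ler_pdivrMr //.
have : degenerate (w + z *: u).
  split; first by rewrite mulmxDr A0w -scalemxAr A0u scaler0 addr0.
  by rewrite hessian_dirD hessian_dirZ mulmxDr mulmxDl -scalemxAr -scalemxAl.
move/wZ; rewrite opprD addrA subrr add0r nrmN nrmZ => /le_trans; apply.
by rewrite ler_wpM2l ?normc_ge0 // lerDl.
Qed.

(** The projection w = N M v of v to the kernel differs from v by G A0 v, which
is small as v is in the image of V2; hence w is still at distance d / 2 from the
exceptional set. *)
Lemma sample_of_distance (d : R) : 0 < d -> exists (b dl : R), 0 < dl /\
  forall (p : svd_point) v, dist_xi p < dl -> im (V2 p) v -> enorm v = 1 ->
    at_distance d degenerate v ->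
    exists q : sample b, sm_pt q = p /\ sm_v q = v.
Proof.
move=> d0.
have [c [d1 [c0 d10 H1]]] := isOM (isOM (isO_cst dist_xi G) isO_A0V2)
  (isO_ct isO_V2).
have d20 : 0 < d / 2 by rewrite divr_gt0.
have [b' Hb'] := degenerate_inv_bound (nrm N * nrm M * n%:R) d20.
pose c1 := c * n%:R; have c10 : 0 <= c1 by rewrite mulr_ge0.
(* the second radius ensures that v and w are at distance at most d / 2 *)
exists (c1 + n%:R + `|b'|), (Num.min d1 (d / 2 / (c1 + 1))); split.
  by rewrite lt_min d10 !divr_gt0 // ltr_wpDl.
move=> p v; rewrite lt_min => /andP[/H1 Hp pd vim v1 vZ].
have vn : nrm v <= n%:R by rewrite (le_trans (nrm_le_enorm _)) // v1 mulr1.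
have vproj := last_cols_proj (pt_V_unitary p) vim.
pose w := N *m (M *m v).
have vwE : v - w = G *m (A0 *m V2 p) *m (V2 p)^t* *m v.
  by rewrite -!mulmxA vproj /w !mulmxA -GE mulmxBl mul1mx opprB addrC subrK.
have e0 := dist_xi_ge0 p.
have vw : nrm (v - w) <= c1 * dist_xi p.
  rewrite vwE (le_trans (nrmM _ _)) // /c1 mulrAC.
  by apply: ler_pM; rewrite ?nrm_ge0 // (le_trans Hp) // expr1.
have A0w : A0 *m w = 0 by rewrite /w mulmxA A0N mul0mx.
have wn : nrm w <= nrm N * nrm M * n%:R.
  rewrite /w mulmxA (le_trans (nrmM _ _)) //.
  by apply: ler_pM; rewrite ?nrm_ge0 // nrmM.
have wZ z : degenerate z -> d / 2 <= nrm (w - z).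
  move=> /vZ dz; have := le_trans dz (enorm_le_nrm _).
  have -> : v - z = (v - w) + (w - z) by rewrite addrA subrK.
  move/le_trans/(_ (nrmD _ _)).
  move: pd; rewrite ltr_pdivlMr ?ltr_wpDl // => pd; nra.
have [Mwu Mwi] := Hb' w A0w wn wZ.
have n0 : 0 <= n%:R :> R by []. have b0 := normr_ge0 b'.
have vb : nrm v <= c1 + n%:R + `|b'| by lra.
have vwb : nrm (v - w) <= (c1 + n%:R + `|b'|) * dist_xi p by nra.
have ib : nrm (invmx (Mw w)) <= c1 + n%:R + `|b'| by have := ler_norm b'; lra.
by exists (Sample vim vb vwb Mwu ib).
Qed.

(** The third condition on r makes one step at least halve the error, so that the
iterates stay in the ball. *)
Lemma quadratic_contraction (d : R) : 0 < d -> exists r K : R,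
  [/\ 0 < r < 1, 0 < K, 2 * (K * r) <= 1,
    forall x U V s tau v, enorm (x - xi) < r ->
      svd_with_corank f k x U V s tau ->
      unit_sample le_kn V v -> at_distance d degenerate v ->
      second_step_mx f le_kn (first_step f le_kn x U V s) U V v \in unitmx
  & forall x v x'', enorm (x - xi) < r ->
      two_step_newton f le_kn x v x'' -> at_distance d degenerate v ->
      enorm (x'' - xi) <= K * enorm (x - xi) ^+ 2].
Proof.
move=> d0; have [b [d1 [d10 H1]]] := sample_of_distance d0.
have [d2 d20 H2] := sample_unit b.
have [c [d3 [c0 d30 H3]]] := isO_newton_step b.
pose K := c * n%:R ^+ 2 + 1.
have K0 : 0 < K by rewrite ltr_wpDl // mulr_ge0 ?sqr_ge0.
have K20 : 0 < (2 * K)^-1 by rewrite invr_gt0 mulr_gt0.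
have [|r0 /andP[r00 r01] Hr] := @near_xi (Num.min d1 (Num.min d2 d3)).
  by rewrite !lt_min d10 d20.
exists (Num.min r0 (2 * K)^-1), K; split=> //.
- by rewrite lt_min gt_min r00 K20 r01.
- rewrite mulrA mulrC -ler_pdivlMr ?mulr_gt0 // div1r.
  by rewrite ge_min lexx orbT.
- move=> x U V s tau v; rewrite lt_min => /andP[/Hr + _].
  rewrite !lt_min => /and3P[x1 x2 _] [svd _] [vim v1] vZ.
  have [q [qp qv]] := H1 (SvdPoint svd) v x1 vim v1 vZ.
  by have := H2 q; rewrite /sm_dist qp qv; apply.
move=> x v x''; rewrite lt_min => /andP[/Hr + _].
rewrite !lt_min => /and3P[x1 _ x3] [U [V [s [tau [delta /= []]]]]].
move=> [svd _] [vim v1] _ Bd -> vZ.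
have [q [qp qv]] := H1 (SvdPoint svd) v x1 vim v1 vZ.
have := H3 (@NewtonStep b q delta _).
rewrite /nw_dist /sm_dist /= qp qv /= => /(_ Bd x3) Hx.
apply: le_trans (enorm_le_nrm _) (le_trans Hx _).
rewrite /dist_xi /= /K mulrDl ler_wpDr ?mul1r ?sqr_ge0 // -mulrA ler_wpM2l //.
by rewrite -exprMn ler_pXn2r ?nnegrE ?nrm_ge0 ?mulr_ge0 ?enorm_ge0 ?nrm_le_enorm.
Qed.

End Local.

(** * Convergence of the iteration *)
Lemma quadratic_cvg (R : realType) (e : nat -> R) (K r : R) :
  0 < K -> 2 * (K * r) <= 1 -> (forall m, 0 <= e m) -> e 0%N < r ->
  (forall m, e m < r -> e m.+1 <= K * e m ^+ 2) ->
  (forall m, e m.+1 <= K * e m ^+ 2) /\ (e @ \oo --> (0 : R)).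
Proof.
move=> K0 Kr e0 er step.
have half m : e m < r -> e m.+1 <= e m * 2^-1.
  move=> emr; apply: le_trans (step m emr) _; rewrite expr2 mulrCA.
  by rewrite ler_wpM2l //; have := ler_wpM2l (ltW K0) (ltW emr); lra.
have small m : e m < r /\ e m <= e 0%N * 2^-1 ^+ m.
  elim: m => [|m [IHr IH]]; first by rewrite expr0 mulr1.
  have h := half m IHr; split.
    by apply: le_lt_trans h _; apply: le_lt_trans _ IHr; have := e0 m; lra.
  apply: le_trans h _; rewrite exprSr mulrA ler_wpM2r ?invr_ge0 //.
split=> [m|]; first by apply: step; case: (small m).
apply: (@squeeze_cvgr _ _ _ _ (fun=> 0) (geometric (e 0%N) 2^-1)).
- by near=> m; rewrite e0 /=; case: (small m).
- exact: cvg_cst.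
- by apply: cvg_geometric; rewrite ger0_norm ?invr_ge0 // invf_lt1 // ltr1n.
Unshelve. all: by end_near.
Qed.

Theorem theorem12 (R : realType) (n : nat) (f : polysys R n)
    (xi : 'cV[R[i]]_n) (hxi : deflation_one_singular_zero f xi) :
  let le_kn := ker_dim_le (jacobian f xi) in
  (exists2 r : R, 0 < r < 1 &
     forall (x : 'cV[R[i]]_n) (U V : 'M[R[i]]_n) (s : 'rV[R]_n) (tau : R),
       0 < enorm (x - xi) < r ->
       svd_with_corank f (ker_dim (jacobian f xi)) x U V s tau ->
       almost_all_in (im (last_cols le_kn V))
         [set v | second_step_mx f le_kn (first_step f le_kn x U V s) U V v
                    \in unitmx])
  /\
  exists Z : set 'cV[R[i]]_n,
    [/\ algebraic_set Z, Z `<` ker (jacobian f xi) &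
    forall d : R, 0 < d ->
    exists r K : R, [/\ 0 < r < 1, 0 < K &
    forall x : 'cV[R[i]]_n, 0 < enorm (x - xi) < r ->
      [/\ forall (U V : 'M[R[i]]_n) (s : 'rV[R]_n) (tau : R) (v : 'cV[R[i]]_n),
            svd_with_corank f (ker_dim (jacobian f xi)) x U V s tau ->
            unit_sample le_kn V v -> at_distance d Z v ->
            second_step_mx f le_kn (first_step f le_kn x U V s) U V v
              \in unitmx,
          forall v x'' : 'cV[R[i]]_n,
            two_step_newton f le_kn x v x'' -> at_distance d Z v ->
            enorm (x'' - xi) <= K * enorm (x - xi) ^+ 2
        & forall xs vs : nat -> 'cV[R[i]]_n,
            xs 0%N = x ->
            (forall m, two_step_newton f le_kn (xs m) (vs m) (xs m.+1)) ->
            (forall m, at_distance d Z (vs m)) ->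
            (forall m, enorm (xs m.+1 - xi) <= K * enorm (xs m - xi) ^+ 2) /\
            (fun m => enorm (xs m - xi)) @ \oo --> (0 : R)]]].
Proof.
move=> le_kn; have [fxi _ _] := hxi.1.
have rA0 : \rank (jacobian f xi) = (n - ker_dim (jacobian f xi))%N.
  by rewrite /ker_dim mxrank_coker subKn // rank_leq_row.
have [G [N [P [M [L [A0N LA0 GE MN AGE]]]]]] :=
  generalized_inverse (erefl (ker_dim (jacobian f xi))).
have [u A0u Mu] := nondegenerate_direction hxi A0N MN AGE.
split.
  have [d d0 Hd] := generic_sample_unit le_kn fxi rA0 LA0 GE A0u Mu.
  have [r r01 Hr] := near_xi xi d0.
  exists r => // x U V s tau /andP[_ /Hr xd] [svd _].
  have [v0 v0im v0u] := Hd (SvdPoint svd) xd; rewrite /= in v0im v0u.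
  set V2 := last_cols le_kn V in v0im *.
  (* linear equations for the image, needed for the algebraic exceptional set *)
  have imE v : im V2 v <-> (1%:M - V2 *m V2^t*) *m v = 0.
    rewrite mulmxBl mul1mx -mulmxA; split=> [vim|/eqP].
      by case: svd => _ Vu _ _ _; rewrite last_cols_proj // subrr.
    by rewrite subr_eq0 => /eqP ->; exists (V2^t* *m v).
  exists [set v | (1%:M - V2 *m V2^t*) *m v = 0 /\
    \det (second_step_mx f le_kn (first_step f le_kn x U V s) U V v) = 0].
  split; first exact: algebraic_singular.
    split=> [v [/imE]//|/(_ v0 v0im)[_]].
    by move: v0u; rewrite unitmxE unitfE => /eqP.
  move=> v /imE vim nv; rewrite /= unitmxE unitfE; apply/eqP => dv.
  by apply: nv.
exists (degenerate f xi N L); split.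
- exact: degenerate_algebraic.
- exact: degenerate_proper A0u Mu.
move=> d d0.
have [r [K [r01 K0 Kr Hunit Hstep]]] :=
  quadratic_contraction le_kn fxi rA0 A0N LA0 GE A0u Mu d0.
exists r, K; split=> // x /andP[_ xr]; split.
- by move=> U V s tau v svd sv vZ; apply: Hunit svd sv vZ.
- by move=> v x'' step vZ; apply: Hstep xr step vZ.
move=> xs vs xs0 step vZ.
apply: (@quadratic_cvg R (fun m => enorm (xs m - xi)) K r K0 Kr) => [m||m mr].
  exact: enorm_ge0.
  by rewrite xs0.
exact: Hstep mr (step m) (vZ m).
Qed.
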